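(* Let $(M,g)$ be a complete Riemannian manifold, let $\ell>0$, and let $\gamma:[0,\mathcal{L}(\gamma)]\to M$ be a regular tractrix, parametrized by arc length $s$, with pole length $\ell$, poles $\lambda_s(u)$, $u\in[0,\ell]$, and tractor $\eta$. Then the length $\mathcal{L}(\eta)$ of the tractor curve and the area $\mathcal{A}$ swept out by the wagon pole are given by $$\mathcal{L}(\eta)=\int_0^{\mathcal{L}(\gamma)}\sqrt{1+\kappa^2(s)\,J_s^2(\ell)}\;ds,\qquad \mathcal{A}=\int_0^{\mathcal{L}(\gamma)}\int_0^{\ell}\kappa(s)\,J_s(u)\,du\,ds .$$
   Context: $(M,g)$ has Levi-Civita covariant derivative $D$ and curvature tensor $R$. A tractor curve is a smooth piecewise regular curve $\eta(t)$ in $M$. A pulled tractrix (put $\varepsilon=+1$), respectively pushed tractrix (put $\varepsilon=-1$), of $\eta$ with pole length $\ell>0$ is a curve $\gamma$ such that, in an arc length parameter $s$, the unit speed geodesic $\lambda_s(u)$ with $\lambda_s(0)=\gamma(s)$ and $\lambda_s'(0)=\varepsilon\gamma'(s)$ satisfies $\lambda_s(\ell)=\eta(t(s))$ for some $t=t(s)$. The geodesic segment $\lambda_s(u)$, $u\in[0,\ell]$, is the (wagon) pole at $s$. The relevant tractor is the curve $s\mapsto\lambda_s(\ell)=\eta(t(s))$, $s\in[0,\mathcal{L}(\gamma)]$, and $\mathcal{L}(\cdot)$ denotes length. The geodesic curvature of $\gamma$ is $\kappa(s)=\|D_{\gamma'(s)}\gamma'(s)\|$. Let $\mathcal{J}_s(u)$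 be the Jacobi field along $\lambda_s$, orthogonal to $\lambda_s'$, with $\mathcal{J}_s(0)=0$, $\mathcal{J}_s'(0)=\varepsilon D_{\gamma'(s)}\gamma'(s)$ and $D^2_{\lambda_s'(u)}\mathcal{J}_s(u)+R(\mathcal{J}_s(u),\lambda_s'(u))\lambda_s'(u)=0$. For $\kappa(s)>0$ put $J_s(u)=\|\mathcal{J}_s(u)\|/\kappa(s)$; the product $\kappa(s)J_s(u)$ always means $\|\mathcal{J}_s(u)\|$, which is $0$ when $\kappa(s)=0$. The area $\mathcal{A}$ swept out by the pole is the area, counted with multiplicity, of the map $r(s,u)=\lambda_s(u)$ on $[0,\mathcal{L}(\gamma)]\times[0,\ell]$, i.e. the integral over this rectangle of the area of the parallelogram spanned by $\partial_s r$ and $\partial_u r$. *)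

(* Defs.v *)
From HB Require Import structures.
From mathcomp Require Import all_boot all_order all_algebra.
From mathcomp Require Import all_classical all_reals all_analysis.

Set Implicit Arguments.
Unset Strict Implicit.
Unset Printing Implicit Defensive.

Import Order.TTheory GRing.Theory Num.Theory.
Import numFieldNormedType.Exports.

Local Open Scope classical_set_scope.
Local Open Scope ring_scope.

Fixpoint Ck_on (R : realType) (n : nat) (W : normedModType R) (k : nat)
    (U : set 'rV[R]_n) (f : 'rV[R]_n -> W) : Prop :=
  if k is k'.+1 then
    (forall x, U x -> differentiable f x) /\
    (forall v : 'rV[R]_n, Ck_on k' U ('D_v f))
  else forall x, U x -> {for x, continuous f}.

(* Meaningful for open U, since [differentiable] is two-sided. *)
Definition smooth_on (R : realType) (n : nat) (W : normedModType R)
    (U : set 'rV[R]_n) (f : 'rV[R]_n -> W) : Prop :=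
  forall k, Ck_on k U f.

Definition smooth_at (R : realType) (V : normedModType R) (f : R -> V) (t : R)
    : Prop :=
  \forall s \near t, forall k, derivable (derive1n k f) s 1.

(* An atlas of charts [coord i : cdom i -> R^n] on M, with inverse [cinv i]
   on the image; all of these are total functions, with irrelevant values off
   their domains. [chart_at p] selects one chart around p; it is used only to
   evaluate quantities that do not depend on the chart. *)
Record smooth_structure (R : realType) (n : nat) (M : topologicalType) :=
  SmoothStructure {
    chart : Type;
    cdom : chart -> set M;
    coord : chart -> M -> 'rV[R]_n;
    cinv : chart -> 'rV[R]_n -> M;
    chart_at : M -> chart;
    chart_atP : forall p, cdom (chart_at p) p;
    cdom_open : forall i, open (cdom i);
    cimg_open : forall i, open (coord i @` cdom i);
    coordK : forall i p, cdom i p -> cinv i (coord i p) = p;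
    coord_continuous : forall i p, cdom i p -> {for p, continuous (coord i)};
    cinv_continuous : forall i x,
      (coord i @` cdom i) x -> {for x, continuous (cinv i)};
    transition_smooth : forall i j,
      smooth_on (coord i @` (cdom i `&` cdom j)) (coord j \o cinv i);
    manifold_hausdorff : hausdorff_space M;
    manifold_second_countable : @second_countable M
  }.

(* Tangent vectors in the classical way: a coordinate vector in every chart
   around the base point p, transforming by the Jacobians of the transition
   maps. The values in charts not containing p are irrelevant, so equality of
   tangent vectors at p is [eq_tvec p]. *)
Definition tvec (R : realType) (n : nat) (M : topologicalType)
    (A : smooth_structure R n M) : Type :=
  chart A -> 'rV[R]_n.

Definition is_tangent (R : realType) (n : nat) (M : topologicalType)
    (A : smooth_structure R n M) (p : M) (v : tvec A) : Prop :=
  forall i j, cdom i p -> cdom j p ->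
    v j = 'd (coord j \o cinv i) (coord i p) (v i).

Definition eq_tvec (R : realType) (n : nat) (M : topologicalType)
    (A : smooth_structure R n M) (p : M) (v w : tvec A) : Prop :=
  forall i, cdom i p -> v i = w i.

Definition zero_tvec (R : realType) (n : nat) (M : topologicalType)
    (A : smooth_structure R n M) : tvec A :=
  fun=> 0.
Arguments zero_tvec {R n M} A _.

(* Smoothness at t includes smoothness on a neighbourhood of t; hence a curve
   that is [smooth_curve_at] every point of a closed interval is smooth there
   up to and including the end points, i.e. extends smoothly beyond them. *)
Definition smooth_curve_at (R : realType) (n : nat) (M : topologicalType)
    (A : smooth_structure R n M) (c : R -> M) (t : R) : Prop :=
  {for t, continuous c} /\
  (forall i : chart A, cdom i (c t) -> smooth_at (coord i \o c) t).

Definition velocity (R : realType) (n : nat) (M : topologicalType)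
    (A : smooth_structure R n M) (c : R -> M) (t : R) : tvec A :=
  fun i => derive1 (coord i \o c) t.
Arguments velocity {R n M} A c t _.

Definition smooth_field_at (R : realType) (n : nat) (M : topologicalType)
    (A : smooth_structure R n M) (c : R -> M) (V : R -> tvec A) (t : R)
    : Prop :=
  (\forall s \near t, is_tangent (c s) (V s)) /\
  (forall i : chart A, cdom i (c t) -> smooth_at (V ^~ i) t).

Record riemannian_metric (R : realType) (n : nat) (M : topologicalType)
    (A : smooth_structure R n M) := RiemannianMetric {
  gcoef : chart A -> 'rV[R]_n -> 'M[R]_n;
  gcoef_smooth : forall i (a b : 'I_n),
    smooth_on (coord i @` cdom i) (fun x => gcoef i x a b : R^o);
  gcoef_sym : forall i x, (coord i @` cdom i) x -> (gcoef i x)^T = gcoef i x;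
  gcoef_pos : forall i x (v : 'rV[R]_n), (coord i @` cdom i) x -> v != 0 ->
    0 < (v *m gcoef i x *m v^T) 0 0;
  gcoef_tensor : forall i j p (v w : tvec A), cdom i p -> cdom j p ->
    is_tangent p v -> is_tangent p w ->
    v i *m gcoef i (coord i p) *m (w i)^T =
    v j *m gcoef j (coord j p) *m (w j)^T
}.

Definition ginner (R : realType) (n : nat) (M : topologicalType)
    (A : smooth_structure R n M) (g : riemannian_metric A)
    (p : M) (v w : tvec A) : R :=
  let i := chart_at A p in
  (v i *m gcoef g i (coord i p) *m (w i)^T) 0 0.

Definition gnorm (R : realType) (n : nat) (M : topologicalType)
    (A : smooth_structure R n M) (g : riemannian_metric A)
    (p : M) (v : tvec A) : R :=
  Num.sqrt (ginner g p v v).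

Definition pderiv (R : realType) (n : nat) (a : 'I_n)
    (f : 'rV[R]_n -> R) (x : 'rV[R]_n) : R :=
  'D_(delta_mx 0 a) (f : 'rV[R]_n -> R^o) x.

(* Index order: [christoffel g i k a b] is Gamma^k_{ab} in the chart i. *)
Definition christoffel (R : realType) (n : nat) (M : topologicalType)
    (A : smooth_structure R n M) (g : riemannian_metric A) (i : chart A)
    (k a b : 'I_n) (x : 'rV[R]_n) : R :=
  2^-1 * \sum_(l < n) invmx (gcoef g i x) k l *
    (pderiv a (fun y => gcoef g i y l b) x
     + pderiv b (fun y => gcoef g i y l a) x
     - pderiv l (fun y => gcoef g i y a b) x).

Definition covD (R : realType) (n : nat) (M : topologicalType)
    (A : smooth_structure R n M) (g : riemannian_metric A)
    (c : R -> M) (V : R -> tvec A) (t : R) : tvec A :=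
  fun i => derive1 (V ^~ i) t +
    \row_(k < n) \sum_(a < n) \sum_(b < n)
      christoffel g i k a b (coord i (c t)) *
      velocity A c t i 0 a * V t i 0 b.

(* The d_k-component of R(d_a, d_b) d_c, for the sign convention
   R(X, Y) Z = D_X D_Y Z - D_Y D_X Z - D_[X, Y] Z. *)
Definition curvature_coef (R : realType) (n : nat) (M : topologicalType)
    (A : smooth_structure R n M) (g : riemannian_metric A) (i : chart A)
    (k a b c : 'I_n) (x : 'rV[R]_n) : R :=
  pderiv a (christoffel g i k b c) x - pderiv b (christoffel g i k a c) x
  + \sum_(m < n) (christoffel g i k a m x * christoffel g i m b c x
                  - christoffel g i k b m x * christoffel g i m a c x).

Definition curvature (R : realType) (n : nat) (M : topologicalType)
    (A : smooth_structure R n M) (g : riemannian_metric A)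
    (p : M) (X Y Z : tvec A) : tvec A :=
  fun i => \row_(k < n) \sum_(a < n) \sum_(b < n) \sum_(c < n)
    curvature_coef g i k a b c (coord i p) * X i 0 a * Y i 0 b * Z i 0 c.

Definition geodesic (R : realType) (n : nat) (M : topologicalType)
    (A : smooth_structure R n M) (g : riemannian_metric A) (c : R -> M)
    : Prop :=
  forall t, smooth_curve_at A c t /\
    eq_tvec (c t) (covD g c (velocity A c) t) (zero_tvec A).

(* Geodesic completeness: exp_p is defined on all of T_p M, for every p. *)
Definition complete_metric (R : realType) (n : nat) (M : topologicalType)
    (A : smooth_structure R n M) (g : riemannian_metric A) : Prop :=
  forall (p : M) (v : tvec A), is_tangent p v ->
    exists c : R -> M,
      [/\ geodesic g c, c 0 = p & eq_tvec p (velocity A c 0) v].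

Definition jacobi_field (R : realType) (n : nat) (M : topologicalType)
    (A : smooth_structure R n M) (g : riemannian_metric A) (c : R -> M)
    (V : R -> tvec A) : Prop :=
  forall t, smooth_field_at c V t /\
    eq_tvec (c t)
      (fun i => covD g c (covD g c V) t i
                + curvature g (c t) (V t) (velocity A c t) (velocity A c t) i)
      (zero_tvec A).

(* In the two definitions below the boundary of the domain of integration is
   left out: it is a null set, and the curve c (resp. the map r) is only
   prescribed for parameters in [a, b], so that [velocity], which is two-sided,
   would not be meaningful there. *)
Definition curve_length (R : realType) (n : nat) (M : topologicalType)
    (A : smooth_structure R n M) (g : riemannian_metric A)
    (c : R -> M) (a b : R) : \bar R :=
  (\int[lebesgue_measure]_(t in `]a, b[)
     (gnorm g (c t) (velocity A c t))%:E)%E.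

Definition parallelogram_area (R : realType) (n : nat) (M : topologicalType)
    (A : smooth_structure R n M) (g : riemannian_metric A)
    (p : M) (v w : tvec A) : R :=
  Num.sqrt (ginner g p v v * ginner g p w w - ginner g p v w ^+ 2).

Definition map_area (R : realType) (n : nat) (M : topologicalType)
    (A : smooth_structure R n M) (g : riemannian_metric A)
    (r : R -> R -> M) (a b c d : R) : \bar R :=
  (\int[lebesgue_measure \x lebesgue_measure]_(x in
      (`]a, b[ `*` `]c, d[ : set (R * R)))
     (parallelogram_area g (r x.1 x.2)
        (velocity A (r ^~ x.2) x.1) (velocity A (r x.1) x.2))%:E)%E.

(* A smooth piecewise regular curve on the interval T: on compact subintervals
   the velocity vanishes at finitely many parameters only. *)
Definition tractor_curve (R : realType) (n : nat) (M : topologicalType)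
    (A : smooth_structure R n M) (T : set R) (eta : R -> M) : Prop :=
  [/\ is_interval T,
      forall t, T t -> smooth_curve_at A eta t
    & forall a b, `[a, b]%classic `<=` T ->
        finite_set [set t | `[a, b]%classic t /\
                            eq_tvec (eta t) (velocity A eta t) (zero_tvec A)]].

(* gam : [0, L] -> M, parametrized by arc length, is a pulled (eps = 1) or
   pushed (eps = -1) tractrix of eta : T -> M with pole length ell and poles
   lam s. *)
Definition tractrix (R : realType) (n : nat) (M : topologicalType)
    (A : smooth_structure R n M) (g : riemannian_metric A) (eps ell : R)
    (T : set R) (eta : R -> M) (L : R) (gam : R -> M) (lam : R -> R -> M)
    : Prop :=
  forall s, `[0, L]%classic s ->
    [/\ smooth_curve_at A gam s,
        gnorm g (gam s) (velocity A gam s) = 1,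
        [/\ geodesic g (lam s),
            forall u, gnorm g (lam s u) (velocity A (lam s) u) = 1,
            lam s 0 = gam s
          & eq_tvec (gam s) (velocity A (lam s) 0)
              (fun i => eps *: velocity A gam s i)]
      & exists2 t, T t & lam s ell = eta t].

Definition geodesic_curvature (R : realType) (n : nat) (M : topologicalType)
    (A : smooth_structure R n M) (g : riemannian_metric A) (gam : R -> M)
    (s : R) : R :=
  gnorm g (gam s) (covD g gam (velocity A gam) s).

Definition pole_jacobi_field (R : realType) (n : nat) (M : topologicalType)
    (A : smooth_structure R n M) (g : riemannian_metric A) (eps : R)
    (gam : R -> M) (s : R) (lam_s : R -> M) (JJ : R -> tvec A) : Prop :=
  [/\ jacobi_field g lam_s JJ,
      forall u, ginner g (lam_s u) (JJ u) (velocity A lam_s u) = 0,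
      eq_tvec (gam s) (JJ 0) (zero_tvec A)
    & eq_tvec (gam s) (covD g lam_s JJ 0)
        (fun i => eps *: covD g gam (velocity A gam) s i)].

(* J_s(u). When kappa = 0 the division gives 0, so that kappa * J_s(u) is 0,
   as it should be. *)
Definition pole_jacobi_norm (R : realType) (n : nat) (M : topologicalType)
    (A : smooth_structure R n M) (g : riemannian_metric A)
    (lam_s : R -> M) (JJ : R -> tvec A) (kappa : R) (u : R) : R :=
  gnorm g (lam_s u) (JJ u) / kappa.

(* Main.v *)
From Pilot Require Import Defs.
From HB Require Import structures.
From mathcomp Require Import all_boot all_order all_algebra.
From mathcomp Require Import all_classical all_reals all_analysis.
From mathcomp Require Import measurable_realfun.
From mathcomp Require Import ring lra.

Set Implicit Arguments.
Unset Strict Implicit.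
Unset Printing Implicit Defensive.

Import Order.TTheory GRing.Theory Num.Theory.
Import numFieldNormedType.Exports.

Local Open Scope classical_set_scope.
Local Open Scope ring_scope.

(** The poles form a map r(s,u) = lambda_s(u), each of whose curves in the
    variable u is a geodesic. The whole proof rests on the formula

      d_s r = eps d_u r + J_s,                                        (1)

    where J_s is the normal Jacobi field given along lambda_s: both sides are
    Jacobi fields along lambda_s with the value gamma'(s) and the covariant
    derivative eps D gamma'(s) at u = 0. Since d_u r is a unit vector orthogonal
    to J_s, Pythagoras gives |d_s r|^2 = 1 + |J_s|^2, which at u = ell is the
    integrand of the length, and the parallelogram spanned by d_s r and d_u r
    has the area |J_s|, the integrand of the area ([pole_ginner], [pole_speed],
    [pole_area]). If kappa(s) = 0, then (1) also holds with the zero field in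
    the place of J_s, hence J_s = 0, so that |J_s| is kappa(s) J_s(u) in all
    cases ([pole_jacobi_curvature]).

    To prove (1) one must differentiate r with respect to s, that is, show that
    the geodesic flow depends differentiably on its initial data. In a chart the
    geodesic equation is a first order equation for the position and the
    velocity, with the right hand side [geodesic_field]. For such an equation,
    [ode_family_derivable] says that on a short interval a family of solutions
    which is differentiable in the parameter at one end is so everywhere, and
    that its derivative is the solution of the linearized equation. By
    [velocity_linearized] and [jacobi_linearized] the two fields on the right
    of (1) solve the linearized geodesic equation; for a Jacobi field this is
    the cancellation of the curvature against the second covariant derivative.
    A pole may run through many charts, and (1) is carried along it by real
    induction on u ([global_propagation]). At each change of chart the
    statement about positions and velocities has to be transported; this uses
    that the second derivatives of the transition map are symmetric
    ([variation_at_chart], [derive_sym]). The induction starts at u = 0, where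
    the poles are known through gamma ([pole_variation]).

    The area is an integral over a rectangle and the formula to be proved an
    iterated integral, so that Tonelli's theorem requires |J_s(u)| to be jointly
    measurable. It is continuous in u. For a fixed u it is measurable in s,
    because by (1) it is determined by the speed of the differentiable curve
    s |-> r(s,u), and a derivative is a limit of difference quotients
    ([measurable_ginner_velocity]). By Caratheodory's criterion these two facts
    suffice ([caratheodory_measurable]). *)

(** * Derivatives of vector valued functions *)

(** Derivatives of matrix valued functions are computed entry by entry, so
    that all the calculus below is done with real valued functions. *)
Lemma is_derive_mxP (R : realType) (V : normedModType R) (m n : nat)
    (c : V -> 'M[R]_(m, n)) (t w : V) (v : 'M[R]_(m, n)) :
  is_derive t w c v <->
  forall i k, is_derive t w (fun s => c s i k : R^o) (v i k).
Proof.
split=> [[dc <-] i k|h].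
  have /derivable_mxP dci := dc.
  by apply: DeriveDef; [exact: dci | rewrite derive_mx// mxE].
have dc : derivable c t w by apply/derivable_mxP => i k; case: (h i k).
apply: DeriveDef => //; rewrite derive_mx//; apply/matrixP => i k.
by rewrite mxE; case: (h i k).
Qed.

Lemma is_derive_diff_comp (R : realType) (V W : normedModType R) (f : V -> W)
    (c : R -> V) (t : R) (v : V) :
  differentiable f (c t) -> is_derive t 1 c v ->
  is_derive t 1 (fun s => f (c s)) ('D_v f (c t)).
Proof.
move=> df [/derivable1_diffP dc <-].
have dfc : differentiable (f \o c) t by exact: differentiable_comp.
apply: DeriveDef; first exact/diff_derivable.
by rewrite (deriveE _ dfc) diff_comp//= -!deriveE.
Qed.

Lemma derive_pderiv (R : realType) (n : nat) (f : 'rV[R]_n -> R)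
    (x v : 'rV[R]_n) :
  differentiable (f : _ -> R^o) x ->
  'D_v (f : _ -> R^o) x = \sum_(k < n) v 0 k * pderiv k f x.
Proof.
move=> df; rewrite deriveE// {1}[v]row_sum_delta linear_sum/=.
by apply: eq_bigr => k _; rewrite linearZ/= /pderiv deriveE.
Qed.

Lemma is_derive_line (R : realType) (n : nat) (z w : 'rV[R]_n) (t : R) :
  is_derive t 1 (fun s : R => z + s *: w) w.
Proof.
apply/is_derive_mxP => i k.
have -> : (fun s : R => (z + s *: w) i k : R^o) = cst (z i k) + w i k \*: id.
  by apply/funext => s; rewrite !mxE /= mulrC.
by apply: is_derive_eq; rewrite add0r scaler1.
Qed.

(** * Functions of class C^k in several variables *)

Lemma near_eq_differentiable (R : realType) (V W : normedModType R)
    (f g : V -> W) (x : V) :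
  {near x, f =1 g} -> differentiable f x -> differentiable g x.
Proof.
move=> fg df; have [dc dfo] := (diff_locallyP _ _).1 df.
have fgx : f x = g x by exact: (nbhs_singleton fg).
have go : g \o shift x = cst (g x) + 'd f x +o_ 0 id.
  apply/eqaddoP => e e0; move/eqaddoP : dfo => /(_ e e0) dfo.
  have fg0 : \forall h \near 0, f (h + x) = g (h + x).
    by move: fg; rewrite (near_shift 0) subr0.
  apply: filterS2 fg0 dfo => h fgh.
  by rewrite !fctE/= fgh fgx.
have dg := diff_unique dc go.
by apply/diff_locallyP; rewrite dg.
Qed.

(** Product and quotient rules for the derivatives of a function hold only at
    the points of U, whereas [Ck_on] speaks of the derivatives as total
    functions; this lemma bridges the gap in every closure property below. *)
Lemma Ck_on_ext (R : realType) (n : nat) (W : normedModType R)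
    (U : set 'rV[R]_n) (k : nat) (f g : 'rV[R]_n -> W) :
  open U -> (forall x, U x -> f x = g x) -> Ck_on k U f -> Ck_on k U g.
Proof.
move=> Uo; have nU x : U x -> \forall y \near x, U y.
  by move=> Ux; exact: open_nbhs_nbhs.
elim: k f g => [|k IH] f g fg /=.
  move=> fc x Ux; have fx : f @ x --> f x := fc x Ux.
  suff: g @ x --> g x by [].
  have nfg : {near x, f =1 g} by exact: filterS (nU x Ux).
  by rewrite fg// in fx; exact: cvg_trans (near_eq_cvg nfg) fx.
move=> [df Df]; split=> [x Ux|v].
  by apply: near_eq_differentiable (df x Ux); exact: filterS (nU x Ux).
apply: IH (Df v) => x Ux; apply: near_eq_derive; exact: filterS (nU x Ux).
Qed.

Lemma Ck_onW (R : realType) (n : nat) (W : normedModType R)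
    (U : set 'rV[R]_n) (k : nat) (f : 'rV[R]_n -> W) :
  Ck_on k.+1 U f -> Ck_on k U f.
Proof.
elim: k f => [|k IH] f /= [df Df].
  by move=> x Ux; exact/differentiable_continuous/df.
by split=> // v; exact/IH/Df.
Qed.

Lemma Ck_on_cst (R : realType) (n : nat) (W : normedModType R)
    (U : set 'rV[R]_n) (k : nat) (a : W) :
  Ck_on k U (cst a).
Proof.
elim: k a => [|k IH] a /=; first by move=> x _; exact: cst_continuous.
split=> [x _|v]; first exact: differentiable_cst.
rewrite (_ : 'D_v _ = cst 0)//.
by apply/funext => x; rewrite derive_cst.
Qed.

Lemma Ck_onD (R : realType) (n : nat) (W : normedModType R)
    (U : set 'rV[R]_n) (k : nat) (f g : 'rV[R]_n -> W) :
  open U -> Ck_on k U f -> Ck_on k U g -> Ck_on k U (fun x => f x + g x).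
Proof.
move=> Uo; elim: k f g => [|k IH] f g /=.
  by move=> fc gc x Ux; exact: continuousD (fc x Ux) (gc x Ux).
move=> [df Df] [dg Dg]; split=> [x Ux|v].
  by apply: differentiableD; [exact: df|exact: dg].
apply: Ck_on_ext (IH _ _ (Df v) (Dg v)) => // x Ux.
by rewrite -deriveD//; apply: diff_derivable; [exact: df|exact: dg].
Qed.

Lemma Ck_onM (R : realType) (n : nat) (U : set 'rV[R]_n) (k : nat)
    (f g : 'rV[R]_n -> R^o) :
  open U -> Ck_on k U f -> Ck_on k U g ->
  Ck_on k U (fun x => f x * g x : R^o).
Proof.
move=> Uo; elim: k f g => [|k IH] f g.
  by move=> fc gc x Ux; exact: continuousM (fc x Ux) (gc x Ux).
move=> fk gk; have [df Df] := fk; have [dg Dg] := gk; split=> [x Ux|v].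
  by apply: differentiableM; [exact: df|exact: dg].
have := Ck_onD Uo (IH _ _ (Ck_onW fk) (Dg v)) (IH _ _ (Ck_onW gk) (Df v)).
apply: Ck_on_ext => // x Ux.
by apply/esym/deriveM; apply: diff_derivable; [exact: df|exact: dg].
Qed.

Lemma Ck_onN (R : realType) (n : nat) (U : set 'rV[R]_n) (k : nat)
    (f : 'rV[R]_n -> R^o) :
  open U -> Ck_on k U f -> Ck_on k U (fun x => - f x : R^o).
Proof.
move=> Uo fk.
apply: Ck_on_ext (Ck_onM Uo (Ck_on_cst U k (-1 : R^o)) fk) => // x _.
exact: mulN1r.
Qed.

Lemma Ck_onV (R : realType) (n : nat) (U : set 'rV[R]_n) (k : nat)
    (f : 'rV[R]_n -> R^o) :
  open U -> (forall x, U x -> f x != 0) -> Ck_on k U f ->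
  Ck_on k U (fun x => (f x)^-1 : R^o).
Proof.
move=> Uo f0; elim: k => [|k IH].
  by move=> fc x Ux; exact: continuousV (f0 x Ux) (fc x Ux).
move=> fk; have [df Df] := fk; split=> [x Ux|v].
  by apply: differentiableV; [exact: df|exact: f0].
have fVk := IH (Ck_onW fk).
apply: Ck_on_ext (Ck_onN Uo (Ck_onM Uo (Ck_onM Uo fVk fVk) (Df v))) => // x Ux.
rewrite -expr2 -mulNr exprVn; apply/esym/deriveV; first exact: f0.
exact/diff_derivable/df.
Qed.

Lemma Ck_on_sum (R : realType) (n : nat) (U : set 'rV[R]_n) (k : nat)
    (I : Type) (r : seq I) (P : pred I) (f : I -> 'rV[R]_n -> R^o) :
  open U -> (forall i, P i -> Ck_on k U (f i)) ->
  Ck_on k U (fun x => \sum_(i <- r | P i) f i x : R^o).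
Proof.
move=> Uo fk; elim: r => [|i r IH].
  apply: Ck_on_ext (Ck_on_cst U k (0 : R^o)) => // x _.
  by rewrite big_nil.
case: (boolP (P i)) => Pi.
  apply: Ck_on_ext (Ck_onD Uo (fk _ Pi) IH) => // x _.
  by rewrite big_cons Pi.
by apply: Ck_on_ext IH => // x _; rewrite big_cons (negbTE Pi).
Qed.

Lemma Ck_on_prod (R : realType) (n : nat) (U : set 'rV[R]_n) (k : nat)
    (I : Type) (r : seq I) (f : I -> 'rV[R]_n -> R^o) :
  open U -> (forall i, Ck_on k U (f i)) ->
  Ck_on k U (fun x => \prod_(i <- r) f i x : R^o).
Proof.
move=> Uo fk; elim: r => [|i r IH].
  apply: Ck_on_ext (Ck_on_cst U k (1 : R^o)) => // x _.
  by rewrite big_nil.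
apply: Ck_on_ext (Ck_onM Uo (fk i) IH) => // x _.
by rewrite big_cons.
Qed.

Lemma Ck_on_mxcoord (R : realType) (n p q : nat) (U : set 'rV[R]_n) (k : nat)
    (f : 'rV[R]_n -> 'M[R]_(p, q)) i j :
  open U -> Ck_on k U f -> Ck_on k U (fun x => f x i j : R^o).
Proof.
move=> Uo; elim: k f => [|k IH] f.
  move=> fc x Ux.
  apply: (@continuous_comp _ _ _ f (fun M : 'M[R]_(p, q) => M i j : R^o)).
    exact: fc.
  exact: coord_continuous.
move=> [df Df]; split=> [x Ux|v].
  apply: (@differentiable_comp _ _ _ _ f (fun M : 'M[R]_(p, q) => M i j : R^o)).
    exact: df.
  exact: differentiable_coord.
apply: Ck_on_ext (IH _ (Df v)) => // x Ux.
by rewrite derive_mx ?mxE//; exact/diff_derivable/df.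
Qed.
Lemma Ck_on_det (R : realType) (n p : nat) (U : set 'rV[R]_n) (k : nat)
    (f : 'rV[R]_n -> 'M[R]_p) :
  open U -> (forall i j, Ck_on k U (fun x => f x i j : R^o)) ->
  Ck_on k U (fun x => \det (f x) : R^o).
Proof.
move=> Uo fk; apply: Ck_on_sum => // s _.
by apply: Ck_onM => //; [exact: Ck_on_cst|exact: Ck_on_prod].
Qed.

Lemma Ck_on_invmx (R : realType) (n p : nat) (U : set 'rV[R]_n) (k : nat)
    (f : 'rV[R]_n -> 'M[R]_p) (a b : 'I_p) :
  open U -> (forall x, U x -> f x \in unitmx) ->
  (forall i j, Ck_on k U (fun x => f x i j : R^o)) ->
  Ck_on k U (fun x => invmx (f x) a b : R^o).
Proof.
move=> Uo fu fk.
have dV : Ck_on k U (fun x => (\det (f x))^-1 : R^o).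
  apply: Ck_onV => // [x Ux|]; last exact: Ck_on_det.
  by rewrite -unitfE; exact: fu.
have cof : Ck_on k U (fun x => cofactor (f x) b a : R^o).
  apply: Ck_onM => //; first exact: Ck_on_cst.
  apply: Ck_on_det => // i j; apply: Ck_on_ext (fk (lift b i) (lift a j)) => //.
  by move=> x _; rewrite !mxE.
apply: Ck_on_ext (Ck_onM Uo dV cof) => // x Ux.
by rewrite /invmx fu// !mxE.
Qed.

(** Precomposition with a linear map: the derivative in the direction v of
    f \o lsubmx is that of f in the direction lsubmx v. *)
Lemma Ck_on_lsubmx (R : realType) (n p : nat) (W : normedModType R)
    (U : set 'rV[R]_n) (k : nat) (f : 'rV[R]_n -> W) :
  open U -> Ck_on k U f ->
  Ck_on k ([set z | U (lsubmx z)] : set 'rV[R]_(n + p)) (f \o lsubmx).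
Proof.
move=> Uo.
have Uo' : open ([set z | U (lsubmx z)] : set 'rV[R]_(n + p)).
  apply: (@open_comp _ _ (lsubmx : 'rV[R]_(n + p) -> _) U) => //.
  by move=> z _; exact/differentiable_continuous/differentiable_lsubmx.
elim: k f => [|k IH] f.
  move=> fc z Uz; apply: (@continuous_comp _ _ _ lsubmx f).
    exact/differentiable_continuous/differentiable_lsubmx.
  exact: fc.
move=> [df Df].
have dfl z : U (lsubmx z) -> differentiable (f \o (@lsubmx R 1 n p)) z.
  by move=> Uz; apply: differentiable_comp; [exact: differentiable_lsubmx|exact: df].
split=> [z Uz|v]; first exact: dfl.
suff -> : 'D_v (f \o lsubmx) = ('D_(lsubmx v) f) \o lsubmx by exact: IH _ (Df (lsubmx v)).
apply/funext => z; rewrite /derive/=; congr lim.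
suff e h : lsubmx (h *: v + z) = h *: lsubmx v + lsubmx z.
  by under eq_fun do rewrite e.
by apply/matrixP => i j; rewrite !mxE.
Qed.

(** * Second order estimates and symmetry of second derivatives *)

Lemma ler_coord_norm (R : realType) (n : nat) (w : 'rV[R]_n) (k : 'I_n) :
  `|w 0 k| <= `|w|.
Proof.
rewrite [leRHS]/Num.Def.normr/= mx_normrE.
exact: (le_bigmax _ (fun i => `|w i.1 i.2|) (0, k)).
Qed.

Lemma rV_norm_le (R : realType) (n : nat) (w : 'rV[R]_n) (c : R) :
  0 <= c -> (forall k, `|w 0 k| <= c) -> `|w| <= c.
Proof.
move=> c0 wc; rewrite [leLHS]/Num.Def.normr/= mx_normrE.
by apply: bigmax_le => // -[i k] _; rewrite (ord1 i); exact: wc.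
Qed.

(** Local estimates are stated for a constant C near +oo which is at the same
    time the bound and, through C^-1, the radius: finitely many of them then
    hold together for a single C. *)
Lemma near_pinfty_ball (R : realType) (V : normedModType R) (x : V)
    (P : set V) :
  nbhs x P -> \forall C \near +oo, forall p, `|p - x| < C^-1 -> P p.
Proof.
move=> /nbhs_normP[r /= r0 rP].
near=> C => p pC; apply: rP => /=; rewrite distrC (lt_trans pC)//.
have C0 : 0 < C by near: C; exact: nbhs_pinfty_gt.
by rewrite invf_plt ?posrE//; near: C; apply: nbhs_pinfty_gt; exact: num_real.
Unshelve. all: by end_near. Qed.

Lemma segment_dist_lt (R : realType) (V : normedModType R) (x p q : V)
    (r t : R) :
  `|p - x| < r -> `|q - x| < r -> 0 <= t <= 1 ->
  `|q + t *: (p - q) - x| < r.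
Proof.
move=> px qx /andP[t0 t1].
have -> : q + t *: (p - q) - x = (1 - t) *: (q - x) + t *: (p - x).
  rewrite -[p - q](subrKA x) scalerDr -[x - q]opprB scalerN scalerBl scale1r.
  move: (t *: (p - x)) (t *: (q - x)) => a b.
  by rewrite addrA (addrAC (q + a)) (addrAC q a) (addrAC _ a).
rewrite (le_lt_trans (ler_normD _ _))// !normrZ (ger0_norm t0) ger0_norm ?subr_ge0//.
move: t0; rewrite le_eqVlt => /predU1P[<-|t0]; first by rewrite subr0 mul1r mul0r addr0.
have : 0 <= (1 - t) * (r - `|q - x|) by rewrite mulr_ge0// subr_ge0// ltW.
have : 0 < t * (r - `|p - x|) by rewrite mulr_gt0// subr_gt0.
lra.
Qed.

Lemma derive_mvt (R : realType) (n : nat) (f : 'rV[R]_n -> R^o)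
    (x w : 'rV[R]_n) :
  (forall t : R, 0 <= t <= 1 -> differentiable f (x + t *: w)) ->
  exists2 t : R, 0 <= t <= 1 & f (x + w) - f x = 'D_w f (x + t *: w).
Proof.
move=> df.
have dfc (t : R) : 0 <= t <= 1 ->
    is_derive t 1 (fun t : R => f (x + t *: w)) ('D_w f (x + t *: w)).
  by move=> t01; exact: (is_derive_diff_comp (df t t01) (is_derive_line x w t)).
have [||t t01] := @MVT_segment R (fun t => f (x + t *: w))
    (fun t => 'D_w f (x + t *: w)) 0 1 ler01.
- move=> t; rewrite in_itv/= => /andP[t0 t1]; apply: dfc.
  by rewrite (ltW t0) (ltW t1).
- apply: derivable_within_continuous => t; rewrite in_itv/= => t01.
  by case: (dfc t t01).
- rewrite scale0r addr0 scale1r subr0 mulr1 => ->.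
  by exists t => //; move: t01; rewrite in_itv.
Qed.

Lemma C1_lipschitz (R : realType) (n : nat) (U : set 'rV[R]_n)
    (f : 'rV[R]_n -> R^o) (x : 'rV[R]_n) :
  open U -> U x -> Ck_on 1 U f ->
  \forall C \near +oo, forall p q, `|p - x| < C^-1 -> `|q - x| < C^-1 ->
    `|f p - f q| <= C * `|p - q|.
Proof.
move=> Uo Ux [df Df].
have nU : nbhs x U by exact: open_nbhs_nbhs.
have pb (k : 'I_n) : \forall y \near x, `|pderiv k f y| <= `|pderiv k f x| + 1.
  have /cvgrPdist_lt /(_ _ ltr01) : pderiv k f @ x --> pderiv k f x.
    exact: (Df (delta_mx 0 k) x Ux).
  apply: filterS => y /ltW yx /=; rewrite -lerBlDl.
  by rewrite (le_trans (lerB_dist _ _))// distrC.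
pose B : R := \sum_(k < n) (`|pderiv k f x| + 1).
have allpb : \forall y \near x, forall k, `|pderiv k f y| <= `|pderiv k f x| + 1.
  exact: (@filter_forall _ _ (fun (k : 'I_n) y =>
    `|pderiv k f y| <= `|pderiv k f x| + 1) (nbhs x)).
have nb := @filterI _ _ (nbhs_filter x) _ _ nU allpb.
near=> C => p q px qx.
have Cb : forall p, `|p - x| < C^-1 -> (U `&` [set y | forall k,
    `|pderiv k f y| <= `|pderiv k f x| + 1]) p.
  by near: C; exact: (near_pinfty_ball nb).
have CB : B <= C by near: C; apply: nbhs_pinfty_ge; exact: num_real.
have seg (t : R) : 0 <= t <= 1 -> `|q + t *: (p - q) - x| < C^-1.
  exact: segment_dist_lt.
have [t|t t01] := @derive_mvt R n f q (p - q).
  by move=> /seg/Cb[Ut _]; exact: df.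
have [Ut Dt] := Cb _ (seg t t01).
rewrite [q + (p - q)]addrC subrK => ->; rewrite derive_pderiv; last exact: df.
rewrite (le_trans (ler_norm_sum _ _ _))// (@le_trans _ _ (B * `|p - q|))//.
  rewrite /B mulr_suml ler_sum// => k _; rewrite normrM mulrC.
  apply: ler_pM => //; exact: ler_coord_norm.
by rewrite ler_wpM2r.
Unshelve. all: by end_near. Qed.

(** By the mean value theorem the error is the increment of the derivative in
    the direction p - q between two points of the segment, and the partial
    derivatives are Lipschitz. *)
Lemma C2_taylor (R : realType) (n : nat) (U : set 'rV[R]_n)
    (f : 'rV[R]_n -> R^o) (x : 'rV[R]_n) :
  open U -> U x -> Ck_on 2 U f ->
  \forall C \near +oo, forall p q, `|p - x| < C^-1 -> `|q - x| < C^-1 ->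
    `|f p - f q - 'D_(p - q) f q| <= C * `|p - q| ^+ 2.
Proof.
move=> Uo Ux [df Df].
have lip : \forall C \near +oo, forall k (p q : 'rV[R]_n),
    `|p - x| < C^-1 -> `|q - x| < C^-1 ->
    `|pderiv k f p - pderiv k f q| <= C * `|p - q|.
  by apply: filter_forall => k; exact: (C1_lipschitz Uo Ux (Df (delta_mx 0 k))).
have [C0 lip0] : exists C : R, 0 < C /\ forall k (p q : 'rV[R]_n),
    `|p - x| < C^-1 -> `|q - x| < C^-1 ->
    `|pderiv k f p - pderiv k f q| <= C * `|p - q|.
  near (@pinfty_nbhs R) => C; exists C; split; near: C => //.
  by apply: nbhs_pinfty_gt; exact: num_real.
have [C0gt {}lip0] := lip0.
near=> C => p q px qx.
have CC0 : C0 <= C by near: C; apply: nbhs_pinfty_ge; exact: num_real.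
have CC1 : n%:R * C0 <= C by near: C; apply: nbhs_pinfty_ge; exact: num_real.
have CU : forall p, `|p - x| < C^-1 -> U p.
  by near: C; apply: near_pinfty_ball; exact: open_nbhs_nbhs.
have CVC0 : C^-1 <= C0^-1 by rewrite lef_pV2 ?posrE// (lt_le_trans C0gt).
have seg (t : R) : 0 <= t <= 1 -> `|q + t *: (p - q) - x| < C^-1.
  exact: segment_dist_lt.
have [t|t t01] := @derive_mvt R n f q (p - q).
  by move=> /seg/CU Ut; exact: df.
rewrite [q + (p - q)]addrC subrK => ->.
have dft := df _ (CU _ (seg t t01)); have dfq := df _ (CU _ qx).
rewrite (derive_pderiv _ dft) (derive_pderiv _ dfq) -sumrB.
rewrite (le_trans (ler_norm_sum _ _ _))//.
apply: (@le_trans _ _ (\sum_(k < n) C0 * `|p - q| ^+ 2)); last first.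
  by rewrite sumr_const card_ord -mulr_natl mulrA ler_wpM2r.
apply: ler_sum => k _; rewrite -mulrBr normrM expr2 mulrCA.
rewrite ler_pM//; first exact: ler_coord_norm.
rewrite (le_trans (lip0 k _ _ _ _))//.
- exact: lt_le_trans (seg t t01) CVC0.
- exact: lt_le_trans qx CVC0.
rewrite ler_wpM2l ?(ltW C0gt)// addrC addrA addNr add0r normrZ.
case/andP: t01 => t0 t1; rewrite ger0_norm//.
by rewrite -[leRHS]mul1r ler_wpM2r.
Unshelve. all: by end_near. Qed.
Lemma differentiable_shift (R : realType) (V W : normedModType R) (f : V -> W)
    (x w : V) :
  differentiable f (x + w) -> differentiable (fun y => f (y + w)) x.
Proof.
by move=> df; exact: (@differentiable_comp _ _ _ _ (fun y => y + w) f).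
Qed.

(** The mean value theorem in the direction v for y |-> f (y + w) - f y, then in
    the direction w for the derivative of f in the direction v. *)
Lemma second_difference (R : realType) (n : nat) (U : set 'rV[R]_n)
    (f : 'rV[R]_n -> R^o) (x v w : 'rV[R]_n) :
  Ck_on 2 U f ->
  (forall a b : R, 0 <= a <= 1 -> 0 <= b <= 1 -> U (x + a *: v + b *: w)) ->
  exists a b : R, [/\ 0 <= a <= 1, 0 <= b <= 1 &
    f (x + v + w) - f (x + v) - (f (x + w) - f x) =
    'D_w ('D_v f) (x + a *: v + b *: w)].
Proof.
move=> [df Df] Uvw.
have i0 : 0 <= (0 : R) <= 1 by rewrite lexx ler01.
have i1 : 0 <= (1 : R) <= 1 by rewrite lexx ler01.
have Uv0 (a : R) : 0 <= a <= 1 -> U (x + a *: v).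
  by move=> a01; have := Uvw a 0 a01 i0; rewrite scale0r addr0.
have Uv1 (a : R) : 0 <= a <= 1 -> U (x + a *: v + w).
  by move=> a01; have := Uvw a 1 a01 i1; rewrite scale1r.
have ds (a : R) : 0 <= a <= 1 ->
    differentiable (fun y => f (y + w)) (x + a *: v).
  by move=> a01; apply: differentiable_shift; exact/df/Uv1.
have [a a01 /= fa] := @derive_mvt R n (fun y => f (y + w) - f y : R^o) x v
  (fun a a01 => differentiableB (ds a a01) (df _ (Uv0 a a01))).
have [dDf DDf] := Df v.
have [b b01 fb] := @derive_mvt R n ('D_v f) (x + a *: v) w
  (fun b b01 => dDf _ (Uvw a b a01 b01)).
exists a, b; split=> //; rewrite fa -fb.
rewrite [LHS]deriveB; last 2 first.
  exact/diff_derivable/ds.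
  exact/diff_derivable/df/Uv0.
congr (_ - _); rewrite /derive; congr lim.
by under eq_fun do rewrite /= -addrA.
Qed.

Lemma ler_dist_halves (R : realFieldType) (a b z d : R) :
  `|a - z| < d / 2 -> `|b - z| < d / 2 -> `|a - b| <= d.
Proof.
move=> /ltW az /ltW bz; rewrite -(subrKA z) (le_trans (ler_normD _ _))//.
by rewrite [d]splitr lerD// distrC.
Qed.

(** Schwarz's theorem. The second difference of f over a small parallelogram is
    symmetric in its two sides; by the previous lemma it equals each of the two
    mixed derivatives at some point of the parallelogram, and both are
    continuous. *)
Lemma derive_sym (R : realType) (n : nat) (U : set 'rV[R]_n)
    (f : 'rV[R]_n -> R^o) (x v w : 'rV[R]_n) :
  open U -> U x -> Ck_on 2 U f ->
  'D_w ('D_v f) x = 'D_v ('D_w f) x.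
Proof.
move=> Uo Ux f2; have [df Df] := f2.
have nU : nbhs x U by exact: open_nbhs_nbhs.
have scale2 (h : R) (v' w' y : 'rV[R]_n) : U y ->
    'D_(h *: w') ('D_(h *: v') f) y = h * h * 'D_w' ('D_v' f) y.
  move=> Uy; have [dDf _] := Df v'.
  have nUy : nbhs y U by exact: open_nbhs_nbhs.
  have scale1 (g : 'rV[R]_n -> R^o) z u : differentiable g z ->
      'D_(h *: u) g z = h *: 'D_u g z.
    by move=> dg; rewrite !deriveE// linearZ.
  rewrite (@near_eq_derive _ _ _ _ (h *: 'D_v' f)); last first.
    by apply: (@filterS _ _ (nbhs_filter y)) nUy => z Uz; exact/scale1/df.
  rewrite deriveZ; last exact/diff_derivable/dDf.
  by rewrite scale1 ?scalerA//; exact: dDf.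
apply/eqP; rewrite -subr_eq0 -normr_le0; apply/ler_addgt0Pr => e e0.
rewrite add0r.
have cvw : 'D_w ('D_v f) @ x --> 'D_w ('D_v f) x := (Df v).2 w x Ux.
have cwv : 'D_v ('D_w f) @ x --> 'D_v ('D_w f) x := (Df w).2 v x Ux.
have e2 : 0 < e / 2 by rewrite divr_gt0.
move/cvgrPdist_lt : cvw => /(_ _ e2) cvw.
move/cvgrPdist_lt : cwv => /(_ _ e2) cwv.
have /nbhs_normP[r /= r0 rP] :=
  @filterI _ _ (nbhs_filter x) _ _ nU (@filterI _ _ (nbhs_filter x) _ _ cvw cwv).
have [h h0 hr] : exists2 h : R, 0 < h & h * (`|v| + `|w|) < r.
  have D0 : 0 < `|v| + `|w| + 1 by rewrite ltr_wpDl// addr_ge0.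
  exists (r / (`|v| + `|w| + 1)); first by rewrite divr_gt0.
  by rewrite mulrAC ltr_pdivrMr// ltr_pM2l// ltrDl.
have near_x (a b : R) : 0 <= a <= 1 -> 0 <= b <= 1 ->
    `|x - (x + a *: (h *: v) + b *: (h *: w))| < r.
  move=> /andP[a0 a1] /andP[b0 b1].
  rewrite -addrA opprD addrA subrr add0r normrN (le_lt_trans (ler_normD _ _))//.
  rewrite !normrZ !ger0_norm ?(ltW h0)//.
  apply: (@le_lt_trans _ _ (h * `|v| + h * `|w|)).
    by rewrite lerD// -[leRHS]mul1r ler_wpM2r// mulr_ge0// ltW.
  by rewrite -mulrDr.
have [a [b [a01 b01 E1]]] := second_difference f2
  (fun a b a01 b01 => (rP _ (near_x a b a01 b01)).1).
have near_x' (a' b' : R) : 0 <= a' <= 1 -> 0 <= b' <= 1 ->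
    `|x - (x + a' *: (h *: w) + b' *: (h *: v))| < r.
  by move=> a'01 b'01; rewrite addrAC; exact: near_x.
have [c [d [c01 d01 E2]]] := second_difference f2
  (fun a b a01 b01 => (rP _ (near_x' a b a01 b01)).1).
have [Uy [/= ylt _]] := rP _ (near_x a b a01 b01).
have [Uz [_ /= zlt]] := rP _ (near_x' c d c01 d01).
rewrite scale2// in E1; rewrite scale2// in E2.
have E : 'D_w ('D_v f) (x + a *: (h *: v) + b *: (h *: w)) =
         'D_v ('D_w f) (x + c *: (h *: w) + d *: (h *: v)).
  apply: (@mulfI _ (h * h)); first by rewrite mulf_neq0// gt_eqF.
  apply: (eq_trans (esym E1)); apply: (eq_trans _ E2).
  rewrite (addrAC x (h *: v)).
  have swap (f1 f3 f4 f5 : R) : f1 - f3 - (f4 - f5) = f1 - f4 - (f3 - f5).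
    by ring.
  exact: swap.
by rewrite E in ylt; exact: ler_dist_halves ylt zlt.
Qed.

(** * Differentiable dependence of solutions of an equation on a parameter *)

(** Induction along an interval, by the supremum of the points up to which P
    holds. It serves to continue an estimate as long as a solution stays in a
    ball, and to continue a statement along a curve through many charts. *)
Lemma real_induction (R : realType) (P : R -> Prop) (a b : R) :
  P a ->
  (forall c, a <= c -> c < b -> (forall x, a <= x <= c -> P x) ->
     exists2 d, c < d & forall x, c < x <= d -> x <= b -> P x) ->
  (forall c, a < c -> c <= b -> (forall x, a <= x < c -> P x) -> P c) ->
  forall x, a <= x <= b -> P x.
Proof.
move=> Pa step lim x0 /andP[ax0 x0b].
have ab : a <= b := le_trans ax0 x0b.
pose S := [set x | a <= x <= b /\ forall y, a <= y <= x -> P y].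
have Sa : S a.
  split; first by rewrite lexx.
  by move=> y; rewrite -eq_le => /eqP <-.
have supS : has_sup S.
  by split; [exists a|exists b => y [/andP[_ yb] _]].
set c := sup S.
have ac : a <= c by exact: ub_le_sup supS.2 _ Sa.
have cb : c <= b by apply: ge_sup => [|y [/andP[_ yb] _]] //; exists a.
have Plt y : a <= y < c -> P y.
  move=> /andP[ay yc]; have yc0 : 0 < c - y by rewrite subr_gt0.
  have [z [_ zP]] := sup_adherent yc0 supS; rewrite subKr => yz.
  by apply: zP; rewrite ay ltW.
have Pc : P c.
  move: (ac); rewrite le_eqVlt => /predU1P[<-//|ac']; exact: lim.
have Ple y : a <= y <= c -> P y.
  by move=> /andP[ay]; rewrite le_eqVlt => /predU1P[->//|yc]; apply: Plt; rewrite ay.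
suff bc : b <= c by apply: Ple; rewrite ax0 (le_trans x0b).
rewrite leNgt; apply/negP => cb'.
have [d cd dP] := step c ac cb' Ple.
have mc : c < Num.min d b by rewrite lt_min cd.
have : Num.min d b <= c.
  apply: ub_le_sup supS.2 _ _; split.
    by rewrite (le_trans ac (ltW mc)) ge_min lexx orbT.
  move=> y /andP[ay]; rewrite le_min => /andP[yd yb].
  have [yc|cy] := leP y c; first by apply: Ple; rewrite ay.
  by apply: dP; rewrite // cy.
by rewrite leNgt mc.
Qed.

(** On an interval of length at most 1 / (2 C) no exponential is needed: at
    a point where |E| is largest, the mean value theorem bounds |E| by its
    value at a, the contribution of D, and half of |E| itself. *)
Lemma gronwall_short (R : realType) (N : nat) (E dE : R -> 'rV[R]_N)
    (a b C D : R) :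
  0 <= C -> 0 <= D -> C * (b - a) <= 2^-1 ->
  (forall u, a <= u <= b -> is_derive u 1 E (dE u)) ->
  (forall u, a <= u <= b -> `|dE u| <= C * `|E u| + D) ->
  forall u, a <= u <= b -> `|E u| <= 2 * (`|E a| + D * (b - a)).
Proof.
move=> C0 D0 Cab dEE dEle u /andP[au ub].
have ab : a <= b := le_trans au ub.
have cE : {within `[a, b], continuous (fun u => `|E u|)}.
  apply/continuous_in_subspaceT => z; rewrite inE/= in_itv/= => zab.
  apply: (@continuous_comp _ _ _ E (fun x => `|x|)); last exact: norm_continuous.
  by apply/differentiable_continuous/derivable1_diffP; case: (dEE z zab).
have [m] := EVT_max ab cE; rewrite in_itv/= => /andP[am mb] Em.
have Ele v : a <= v <= b -> `|E v| <= `|E m| by move=> vab; apply: Em; rewrite in_itv.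
suff : `|E m| <= `|E a| + (C * `|E m| + D) * (b - a).
  move=> H; apply: le_trans (Ele u _) _; first by rewrite au.
  have : C * (b - a) * `|E m| <= 2^-1 * `|E m| by rewrite ler_wpM2r.
  lra.
have CD : 0 <= C * `|E m| + D by rewrite addr_ge0// mulr_ge0.
apply: rV_norm_le => [|k]; first by rewrite addr_ge0// mulr_ge0// subr_ge0.
have dk v : a <= v <= b -> is_derive v 1 (fun s => E s 0 k : R^o) (dE v 0 k).
  by move=> /dEE /is_derive_mxP; exact.
have [||c cab Ec] := @MVT_segment R (fun s => E s 0 k) (fun s => dE s 0 k) a m am.
- move=> v; rewrite in_itv/= => /andP[av vm]; apply: dk.
  by rewrite ltW// (le_trans (ltW vm)).
- apply: derivable_within_continuous => v; rewrite in_itv/= => /andP[av vm].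
  by have [] : is_derive v 1 (fun s => E s 0 k : R^o) (dE v 0 k)
    by apply: dk; rewrite av (le_trans vm).
move: cab; rewrite in_itv/= => /andP[ac cm].
have cab : a <= c <= b by rewrite ac (le_trans cm).
rewrite -[E m 0 k](subrK (E a 0 k)) Ec addrC (le_trans (ler_normD _ _))//.
rewrite lerD ?ler_coord_norm// normrM (ger0_norm (_ : 0 <= m - a)) ?subr_ge0//.
rewrite ler_pM ?subr_ge0// ?lerB//.
rewrite (le_trans (ler_coord_norm _ _))// (le_trans (dEle _ cab))//.
by rewrite lerD2r ler_wpM2l// Ele.
Qed.
(** The Jacobian matrix, transposed: vectors are rows, and it acts on them from
    the right. *)
Definition jac (R : realType) (N : nat) (F : 'rV[R]_N -> 'rV[R]_N)
    (q : 'rV[R]_N) : 'M[R]_N :=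
  \matrix_(j, k) pderiv j (fun x => F x 0 k) q.

Lemma C2_field_bounds (R : realType) (N : nat) (U : set 'rV[R]_N)
    (F : 'rV[R]_N -> 'rV[R]_N) (x0 : 'rV[R]_N) :
  open U -> U x0 -> (forall k, Ck_on 2 U (fun x => F x 0 k : R^o)) ->
  \forall C \near +oo, forall p q : 'rV[R]_N, `|p - x0| < C^-1 -> `|q - x0| < C^-1 ->
    [/\ `|F p - F q| <= C * `|p - q|,
        `|F p - F q - (p - q) *m jac F q| <= C * `|p - q| ^+ 2
      & forall w : 'rV[R]_N, `|w *m jac F q| <= C * `|w|].
Proof.
move=> Uo Ux F2.
have lip : \forall C \near +oo, forall k p q,
    `|p - x0| < C^-1 -> `|q - x0| < C^-1 ->
    `|F p 0 k - F q 0 k| <= C * `|p - q|.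
  by apply: filter_forall => k; exact: (C1_lipschitz Uo Ux (Ck_onW (F2 k))).
have taylor : \forall C \near +oo, forall k p q,
    `|p - x0| < C^-1 -> `|q - x0| < C^-1 ->
    `|F p 0 k - F q 0 k - 'D_(p - q) (fun x => F x 0 k : R^o) q|
      <= C * `|p - q| ^+ 2.
  by apply: filter_forall => k; exact: (C2_taylor Uo Ux (F2 k)).
pose B : R := \sum_k \sum_j (`|jac F x0 j k| + 1).
have jb (i : 'I_N * 'I_N) :
    \forall y \near x0, `|jac F y i.1 i.2| <= `|jac F x0 i.1 i.2| + 1.
  have /cvgrPdist_lt /(_ _ ltr01) : pderiv i.1 (fun x => F x 0 i.2) @ x0 -->
      pderiv i.1 (fun x => F x 0 i.2) x0.
    exact: (Ck_onW (F2 i.2)).2 (delta_mx 0 i.1) x0 Ux.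
  apply: filterS => y /ltW yx /=; rewrite -lerBlDl !mxE.
  by rewrite (le_trans (lerB_dist _ _))// distrC.
have alljb : \forall y \near x0, forall i : 'I_N * 'I_N,
    `|jac F y i.1 i.2| <= `|jac F x0 i.1 i.2| + 1.
  exact: (@filter_forall _ _ (fun (i : 'I_N * 'I_N) y =>
    `|jac F y i.1 i.2| <= `|jac F x0 i.1 i.2| + 1) (nbhs x0)).
have nU : nbhs x0 U by exact: open_nbhs_nbhs.
have nb := @filterI _ _ (nbhs_filter x0) _ _ nU alljb.
near=> C => p q px qx.
have C0 : 0 <= C by near: C; apply: nbhs_pinfty_ge; exact: num_real.
have [Uq jq] : (U `&` [set y | forall i : 'I_N * 'I_N,
    `|jac F y i.1 i.2| <= `|jac F x0 i.1 i.2| + 1]) q.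
  by move: q qx; near: C; exact: (near_pinfty_ball nb).
have CB : B <= C by near: C; apply: nbhs_pinfty_ge; exact: num_real.
have F1 k : differentiable (fun x => F x 0 k : R^o) q by exact: (F2 k).1.
split.
- apply: rV_norm_le => [|k]; first by rewrite mulr_ge0.
  by rewrite !mxE; move: k p q px qx {Uq jq F1}; near: C.
- apply: rV_norm_le => [|k]; first by rewrite mulr_ge0// exprn_ge0.
  have -> : (F p - F q - (p - q) *m jac F q) 0 k =
      F p 0 k - F q 0 k - 'D_(p - q) (fun x => F x 0 k : R^o) q.
    have subE (v w : 'rV[R]_N) : (v - w) 0 k = v 0 k - w 0 k by rewrite !mxE.
    rewrite subE subE derive_pderiv//; congr (_ - _).
    by rewrite mxE; apply: eq_bigr => j _; rewrite [jac F q j k]mxE.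
  by move: k p q px qx {Uq jq F1}; near: C.
- move=> w; apply: rV_norm_le => [|k]; first by rewrite mulr_ge0.
  rewrite mxE (le_trans (ler_norm_sum _ _ _))//.
  apply: (@le_trans _ _ (B * `|w|)); last by rewrite ler_wpM2r.
  rewrite /B [in leRHS](bigD1 k)//= mulrDl mulr_suml ler_wpDr//.
    by rewrite mulr_ge0// sumr_ge0// => k' _; rewrite sumr_ge0// => j _; rewrite addr_ge0.
  apply: ler_sum => j _; rewrite normrM mulrC; apply: ler_pM => //.
    exact: (jq (j, k)).
  exact: ler_coord_norm.
Unshelve. all: by end_near. Qed.
(** What the perturbation argument uses of the right hand side F of an
    equation, in a single ball: a Lipschitz bound, a Taylor estimate, and a bound
    on the differential. *)
Definition C2_bounds (R : realType) (N : nat) (F : 'rV[R]_N -> 'rV[R]_N)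
    (x0 : 'rV[R]_N) (C : R) : Prop :=
  0 < C /\ forall p q : 'rV[R]_N, `|p - x0| < C^-1 -> `|q - x0| < C^-1 ->
    [/\ `|F p - F q| <= C * `|p - q|,
        `|F p - F q - (p - q) *m jac F q| <= C * `|p - q| ^+ 2
      & forall w : 'rV[R]_N, `|w *m jac F q| <= C * `|w|].

Lemma is_derive_continuous (R : realType) (V : normedModType R) (f : R -> V)
    (t : R) (v : V) :
  is_derive t 1 f v -> {for t, continuous f}.
Proof. by move=> [df _]; exact/differentiable_continuous/derivable1_diffP. Qed.

(** The solution X is only known on a set dom of times which is not given in
    advance: a geodesic may leave the chart. All that is assumed is that dom is
    open and contains each time up to which X stays in the ball. The Gronwall bound
    keeps X far from the boundary of the ball, so X never leaves it. *)
Lemma ode_solutions_close (R : realType) (N : nat) (F : 'rV[R]_N -> 'rV[R]_N)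
    (x0 : 'rV[R]_N) (C a b : R) (X0 X : R -> 'rV[R]_N) (dom : R -> Prop) :
  C2_bounds F x0 C -> C * (b - a) <= 2^-1 ->
  (forall u, a <= u <= b -> is_derive u 1 X0 (F (X0 u))) ->
  (forall u, a <= u <= b -> `|X0 u - x0| < C^-1 / 2) ->
  dom a ->
  (forall u, a <= u <= b -> dom u -> is_derive u 1 X (F (X u))) ->
  (forall u, a <= u <= b -> dom u -> \forall u' \near u, dom u') ->
  (forall c, a < c -> c <= b ->
     (forall u, a <= u < c -> dom u /\ `|X u - x0| < C^-1) -> dom c) ->
  2 * `|X a - X0 a| < C^-1 / 2 ->
  forall u, a <= u <= b -> dom u /\ `|X u - X0 u| <= 2 * `|X a - X0 a|.
Proof.
move=> [C0 FC] Cab dX0 X0x0 doma dX domo doml small.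
set eta := 2 * _ in small *.
have eta0 : 0 <= eta by rewrite mulr_ge0.
have inball u : a <= u <= b -> `|X u - X0 u| < C^-1 / 2 -> `|X u - x0| < C^-1.
  move=> uab XX; rewrite -(subrKA (X0 u)) (le_lt_trans (ler_normD _ _))//.
  by rewrite [ltRHS]splitr ltrD// X0x0.
have inball0 u : a <= u <= b -> `|X0 u - x0| < C^-1.
  move=> uab; rewrite (lt_le_trans (X0x0 u uab))// ler_pdivrMr//.
  by rewrite ler_peMr ?ler1n// invr_ge0 ltW.
(* The bound holds as long as X stays in the ball; the induction below uses it
   in turn to show that X stays there. *)
have gron d : a <= d <= b ->
    (forall u, a <= u <= d -> dom u /\ `|X u - X0 u| < C^-1 / 2) ->
    forall u, a <= u <= d -> `|X u - X0 u| <= eta.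
  move=> /andP[ad db] Xd u uad.
  have ab' v : a <= v <= d -> a <= v <= b.
    by move=> /andP[-> vd]; rewrite (le_trans vd).
  have /= := @gronwall_short R N (fun v => X v - X0 v)
    (fun v => F (X v) - F (X0 v)) a d C 0 (ltW C0) (lexx _).
  rewrite mul0r addr0; apply=> //.
  - by rewrite (le_trans _ Cab)// ler_wpM2l ?(ltW C0)// lerB.
  - move=> v vad; have [dv _] := Xd v vad.
    by have dXv := dX v (ab' v vad) dv; have dX0v := dX0 v (ab' v vad);
       exact: is_deriveB.
  - move=> v vad; have [dv Xv] := Xd v vad; rewrite addr0.
    by have [] := FC _ _ (inball v (ab' v vad) Xv) (inball0 v (ab' v vad)).
have cXX u : a <= u <= b -> dom u ->
    {for u, continuous (fun v => `|X v - X0 v|)}.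
  move=> uab du.
  apply: (@continuous_comp _ _ _ (fun v => X v - X0 v) (fun x => `|x|));
    last exact: norm_continuous.
  have cX := is_derive_continuous (dX u uab du).
  have cX0 := is_derive_continuous (dX0 u uab).
  exact: continuousB.
have near_dist u : a <= u <= b -> dom u -> `|X u - X0 u| <= eta ->
    \forall v \near u, dom v /\ `|X v - X0 v| < C^-1 / 2.
  move=> uab du Xu; apply: (@filterI _ _ (nbhs_filter u)); first exact: domo.
  have := cXX u uab du; rewrite /= => /cvgr_lt; apply.
  exact: le_lt_trans Xu small.
apply: real_induction => [|c ac cb Pc|c ac cb IH].
- by split=> //; rewrite ler_peMl// ler1n.
- have [dc Xc] : dom c /\ `|X c - X0 c| <= eta by apply: Pc; rewrite ac lexx.
  have cab : a <= c <= b by rewrite ac ltW.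
  have /nbhs_normP[e /= e0 eP] := near_dist c cab dc Xc.
  exists (c + e / 2) => [|x /andP[cx xe] xb]; first by rewrite ltrDl divr_gt0.
  have Px v : a <= v <= x -> dom v /\ `|X v - X0 v| < C^-1 / 2.
    move=> /andP[av vx]; have [vc|cv] := leP v c.
      have [|dv Xv] := Pc v; first by rewrite av.
      by split=> //; exact: le_lt_trans Xv small.
    apply: eP => /=; rewrite distrC gtr0_norm ?subr_gt0//.
    rewrite ltrBlDl (le_lt_trans vx)// (le_lt_trans xe)// ltrD2l.
    by rewrite ltr_pdivrMr// ltr_pMr// ltr1n.
  have axx : a <= x <= x by rewrite lexx (le_trans ac (ltW cx)).
  split; first by have [] := Px x axx.
  by apply: (gron x) => //; rewrite xb (le_trans ac (ltW cx)).
- have dc : dom c.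
    apply: doml => // u uac; have [du Xu] := IH u uac; split=> //.
    have /andP[au uc] := uac.
    apply: inball; last exact: le_lt_trans Xu small.
    by rewrite au (le_trans (ltW uc)).
  split=> //; have cab : a <= c <= b by rewrite cb ltW.
  rewrite leNgt; apply/negP => etac.
  have := cXX c cab dc; rewrite /= => /cvgr_gt /(_ _ etac) /nbhs_normP[e /= e0 eP].
  pose v := Num.max a (c - e / 2).
  have vc : v < c by rewrite gt_max ac ltrBlDr ltrDl divr_gt0.
  have av : a <= v by rewrite le_max lexx.
  have [|_] := IH v; first by rewrite av.
  rewrite leNgt => /negP; apply; apply: eP => /=.
  rewrite gtr0_norm ?subr_gt0// ltrBlDr -ltrBlDl.
  rewrite (@lt_le_trans _ _ (c - e / 2))//; last by rewrite le_max lexx orbT.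
  by rewrite ltrD2l ltrN2 ltr_pdivrMr// ltr_pMr// ltr1n.
Qed.

Lemma is_derive_errorP (R : realType) (V : normedModType R) (f : R -> V)
    (t : R) (v : V) :
  is_derive t 1 f v <->
  forall e : R, 0 < e ->
    \forall s \near t, `|f s - f t - (s - t) *: v| <= e * `|s - t|.
Proof.
have quot (w : V) (s : R) : s != t ->
    `|w - (s - t)^-1 *: (f s - f t)| * `|s - t| = `|f s - f t - (s - t) *: w|.
  move=> st; rewrite mulrC -normrZ scalerBr scalerA divff ?subr_eq0// scale1r.
  by rewrite distrC.
split=> [[/cvg_ex[l fl] <-] e e0|fe].
  have /cvgrPdist_le /(_ e e0) : h^-1 *: ((f \o shift t) (h *: 1) - f t)
      @[h --> 0^'] --> 'D_1 f t.
    by rewrite /derive; have := fl; rewrite (cvg_lim _ fl).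
  move=> /nbhs_normP[d /= d0 dP]; apply/nbhs_normP; exists d => // s std.
  have {}std : `|s - t| < d by rewrite distrC.
  rewrite /=.
  have [->|st] := eqVneq s t; first by rewrite !subrr scale0r subr0 !normr0 mulr0.
  have := dP (s - t); rewrite /= sub0r normrN subr_eq0 => /(_ std st).
  by rewrite [(s - t)%:A]mulr1 subrK => H; rewrite -quot// ler_wpM2r.
suff fl : h^-1 *: ((f \o shift t) (h *: 1) - f t) @[h --> 0^'] --> v.
  by apply: DeriveDef; [apply/cvg_ex; exists v|exact: cvg_lim].
apply/cvgrPdist_le => e e0; apply/nbhs_normP.
have /nbhs_normP[d /= d0 dP] := fe e e0; exists d => // h /=.
rewrite sub0r normrN => hd h0; rewrite [h%:A]mulr1.
have := dP (h + t); rewrite /= opprD addrCA subrr addr0 normrN => /(_ hd).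
have ht : h + t != t by rewrite -subr_eq0 addrK.
by rewrite -quot// addrK ler_pM2r ?normr_gt0.
Qed.

(** The error X - X0 - h Z solves the equation linearized along X0 up to the
    second order remainder of F, which is of the order of |X a - X0 a|^2. *)
Lemma ode_linear_approx (R : realType) (N : nat) (F : 'rV[R]_N -> 'rV[R]_N)
    (x0 : 'rV[R]_N) (C a b : R) (X0 X Z : R -> 'rV[R]_N) (h : R) :
  C2_bounds F x0 C -> C * (b - a) <= 2^-1 ->
  (forall u, a <= u <= b -> is_derive u 1 X0 (F (X0 u))) ->
  (forall u, a <= u <= b -> `|X0 u - x0| < C^-1) ->
  (forall u, a <= u <= b -> is_derive u 1 X (F (X u))) ->
  (forall u, a <= u <= b -> `|X u - x0| < C^-1) ->
  (forall u, a <= u <= b -> `|X u - X0 u| <= 2 * `|X a - X0 a|) ->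
  (forall u, a <= u <= b -> is_derive u 1 Z (Z u *m jac F (X0 u))) ->
  forall u, a <= u <= b -> `|X u - X0 u - h *: Z u| <=
    2 * `|X a - X0 a - h *: Z a| + (2 * `|X a - X0 a|) ^+ 2.
Proof.
move=> [C0 FC] Cab dX0 X0x0 dX Xx0 XX dZ u uab.
set eta := 2 * `|X a - X0 a| in XX *.
have ab : 0 <= b - a by case/andP: uab => au ub; rewrite subr_ge0 (le_trans au).
have /= gron := @gronwall_short R N (fun v => X v - X0 v - h *: Z v)
    (fun v => F (X v) - F (X0 v) - h *: (Z v *m jac F (X0 v))) a b C
    (C * eta ^+ 2) (ltW C0).
apply: le_trans (gron _ Cab _ _ u uab) _.
- by rewrite mulr_ge0 ?(ltW C0)// exprn_ge0// mulr_ge0.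
- move=> v vab; have dXv := dX v vab; have dX0v := dX0 v vab.
  have dZv := dZ v vab; apply: is_deriveB; exact: is_deriveZ.
- move=> v vab; have [_ tay lin] := FC _ _ (Xx0 v vab) (X0x0 v vab).
  set A := F (X v) - F (X0 v); set D := X v - X0 v in tay *.
  have -> : A - h *: (Z v *m jac F (X0 v)) =
      (D - h *: Z v) *m jac F (X0 v) + (A - D *m jac F (X0 v)).
    rewrite mulmxBl -scalemxAl.
    by move: (D *m _) (h *: _) => P Q; rewrite [RHS]addrC [RHS]addrA subrK.
  rewrite (le_trans (ler_normD _ _))// lerD ?lin// (le_trans tay)//.
  by rewrite ler_wpM2l ?(ltW C0)// lerXn2r ?nnegrE// ?(le_trans _ (XX v vab))// XX.
- rewrite mulrDr lerD2l mulrAC mulrA -[leRHS]mul1r ler_wpM2r ?exprn_ge0 ?mulr_ge0//.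
  by rewrite -ler_pdivlMl// mulr1.
Qed.
(** Differentiable dependence on a parameter: by [ode_linear_approx] with
    h = s - s0 the error at time u is at most a multiple of the error at time a
    plus O(h^2), hence o(h). *)
Lemma ode_family_derivable (R : realType) (N : nat)
    (F : 'rV[R]_N -> 'rV[R]_N) (x0 : 'rV[R]_N) (C a b s0 : R)
    (X : R -> R -> 'rV[R]_N) (Z : R -> 'rV[R]_N) (dom : R -> R -> Prop) :
  C2_bounds F x0 C -> C * (b - a) <= 2^-1 ->
  (forall u, a <= u <= b -> is_derive u 1 (X s0) (F (X s0 u))) ->
  (forall u, a <= u <= b -> `|X s0 u - x0| < C^-1 / 2) ->
  (forall u, a <= u <= b -> is_derive u 1 Z (Z u *m jac F (X s0 u))) ->
  (\forall s \near s0, [/\ dom s a,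
     forall u, a <= u <= b -> dom s u -> is_derive u 1 (X s) (F (X s u)),
     forall u, a <= u <= b -> dom s u -> \forall u' \near u, dom s u'
   & forall c, a < c -> c <= b ->
     (forall u, a <= u < c -> dom s u /\ `|X s u - x0| < C^-1) -> dom s c]) ->
  is_derive s0 1 (X ^~ a) (Z a) ->
  forall u, a <= u <= b ->
    (\forall s \near s0, dom s u) /\ is_derive s0 1 (X ^~ u) (Z u).
Proof.
move=> FC Cab dX0 X0x0 dZ good dXa u uab.
have C0 := FC.1.
have inball0 v : a <= v <= b -> `|X s0 v - x0| < C^-1.
  move=> vab; rewrite (lt_le_trans (X0x0 v vab))// ler_pdivrMr//.
  by rewrite ler_peMr ?ler1n// invr_ge0 ltW.
have small : \forall s \near s0, 2 * `|X s a - X s0 a| < C^-1 / 2.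
  have /cvgrPdist_lt : X ^~ a @ s0 --> X s0 a := is_derive_continuous dXa.
  have C4 : 0 < C^-1 / 4 by rewrite divr_gt0 ?invr_gt0.
  move=> /(_ _ C4); apply: filterS => s; rewrite distrC; lra.
have close : \forall s \near s0, forall v, a <= v <= b ->
    dom s v /\ `|X s v - X s0 v| <= 2 * `|X s a - X s0 a|.
  apply: filterS2 good small => s [doma dX domo doml] sm v.
  exact: (ode_solutions_close FC Cab dX0 X0x0 doma dX domo doml sm).
split; first by apply: filterS close => s /(_ u uab)[].
apply/is_derive_errorP => e e0.
(* Differentiability at time a gives |X s a - X s0 a| <= K |s - s0|. *)
pose K := `|Z a| + 1.
have K0 : 0 < K by rewrite ltr_wpDl.
have e4 : 0 < e / 4 by rewrite divr_gt0.
have Ea := (is_derive_errorP _ _ _).1 dXa _ e4.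
have E1 := (is_derive_errorP _ _ _).1 dXa _ ltr01.
have D0 : 0 < e / (8 * K ^+ 2) by rewrite divr_gt0// mulr_gt0// exprn_gt0.
have sd : \forall s \near s0, `|s - s0| < e / (8 * K ^+ 2).
  by apply/nbhs_normP; exists (e / (8 * K ^+ 2)) => // s /=; rewrite distrC.
near=> s.
have [doma dX domo doml] : [/\ dom s a,
     forall u, a <= u <= b -> dom s u -> is_derive u 1 (X s) (F (X s u)),
     forall u, a <= u <= b -> dom s u -> \forall u' \near u, dom s u'
   & forall c, a < c -> c <= b ->
     (forall u, a <= u < c -> dom s u /\ `|X s u - x0| < C^-1) -> dom s c].
  by near: s.
have cl : forall v, a <= v <= b ->
    dom s v /\ `|X s v - X s0 v| <= 2 * `|X s a - X s0 a| by near: s.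
have sm : 2 * `|X s a - X s0 a| < C^-1 / 2 by near: s.
have Xx0 v : a <= v <= b -> `|X s v - x0| < C^-1.
  move=> vab; rewrite -(subrKA (X s0 v)) (le_lt_trans (ler_normD _ _))//.
  by rewrite [ltRHS]splitr ltrD// ?X0x0// (le_lt_trans _ sm)//; case: (cl v vab).
have := ode_linear_approx (s - s0) FC Cab dX0 inball0
  (fun v vab => dX v vab (cl v vab).1) Xx0 (fun v vab => (cl v vab).2) dZ uab.
move=> /le_trans; apply.
have e4a : `|X s a - X s0 a - (s - s0) *: Z a| <= e / 4 * `|s - s0| by near: s.
have e1a : `|X s a - X s0 a - (s - s0) *: Z a| <= 1 * `|s - s0| by near: s.
have sds : `|s - s0| < e / (8 * K ^+ 2) by near: s.
have etaK : `|X s a - X s0 a| <= K * `|s - s0|.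
  rewrite -[X s a - X s0 a](subrK ((s - s0) *: Z a)) (le_trans (ler_normD _ _))//.
  by rewrite addrC /K mulrDl lerD// normrZ mulrC.
have sq : (2 * `|X s a - X s0 a|) ^+ 2 <= e / 2 * `|s - s0|.
  apply: (@le_trans _ _ ((2 * (K * `|s - s0|)) ^+ 2)).
    by rewrite lerXn2r ?nnegrE ?mulr_ge0 ?(ltW K0)// ler_wpM2l.
  have -> : (2 * (K * `|s - s0|)) ^+ 2 = 4 * K ^+ 2 * `|s - s0| * `|s - s0| by ring.
  rewrite ler_wpM2r//.
  move: sds; rewrite ltr_pdivlMr ?mulr_gt0 ?exprn_gt0//; lra.
lra.
Unshelve. all: by end_near. Qed.

(* From here on coord is the coordinate map of a chart, rather than the
   coordinates of a vector in a basis. *)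
Import Pilot.Defs.

(** * Christoffel symbols and the geodesic flow in a chart *)

Lemma is_derive_sumr (R : realType) (V : normedModType R) (I : Type)
    (r : seq I) (f : I -> V -> R) (df : I -> R) (t w : V) :
  (forall i, is_derive t w (f i : V -> R^o) (df i)) ->
  is_derive t w (fun s => \sum_(i <- r) f i s : R^o) (\sum_(i <- r) df i).
Proof.
move=> dfi; elim: r => [|i r IH].
  rewrite big_nil (_ : (fun s => _) = cst 0); first exact: is_derive_cst.
  by apply/funext => s; rewrite big_nil.
rewrite big_cons (_ : (fun s => _) = f i + (fun s => \sum_(j <- r) f j s)).
  exact: is_deriveD.
by apply/funext => s; rewrite big_cons.
Qed.

Lemma is_derive_unique (R : realType) (V W : normedModType R) (f : V -> W)
    (t w : V) (a b : W) :
  is_derive t w f a -> is_derive t w f b -> a = b.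
Proof. by move=> [_ <-] [_ <-]. Qed.

Lemma Ck_on_coord (R : realType) (n : nat) (U : set 'rV[R]_n) (k : nat)
    (j : 'I_n) :
  open U -> Ck_on k U (fun z => z 0 j : R^o).
Proof.
move=> Uo; apply: (Ck_on_mxcoord (f := id)) => //.
case: k => [|k]; first by move=> x _; exact: cvg_id.
split=> [x _|v]; first exact: ex_diff.
by rewrite (_ : 'D_v _ = cst v); [exact: Ck_on_cst|apply/funext => x; exact: derive_id].
Qed.

Definition cimg (R : realType) (n : nat) (M : topologicalType)
    (A : smooth_structure R n M) (i : chart A) : set 'rV[R]_n :=
  coord i @` cdom i.

Section Christoffel.
Context (R : realType) (n : nat) (M : topologicalType).
Context (A : smooth_structure R n M) (g : riemannian_metric A) (i : chart A).
Implicit Types (x p q r v : 'rV[R]_n).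

Let gcoef_unit x : cimg i x -> gcoef g i x \in unitmx.
Proof.
move=> ix; rewrite unitmxE unitfE; apply/negP => /det0P[v v0 vg].
by have := gcoef_pos g ix v0; rewrite vg mul0mx mxE ltxx.
Qed.

Lemma christoffel_smooth k a b m :
  Ck_on m (cimg i) (christoffel g i k a b : _ -> R^o).
Proof.
have io : open (cimg i) by exact: cimg_open.
apply: Ck_onM => //; first exact: Ck_on_cst.
apply: Ck_on_sum => // l _; apply: Ck_onM => //.
  by apply: Ck_on_invmx => // a' b'; exact: gcoef_smooth.
have dg c a' b' : Ck_on m (cimg i) (pderiv c (fun y => gcoef g i y a' b') : _ -> R^o).
  exact: (gcoef_smooth g i a' b' m.+1).2.
by apply: Ck_onD => //; [exact: Ck_onD|exact: Ck_onN].
Qed.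

Lemma christoffelC k a b x : cimg i x ->
  christoffel g i k a b x = christoffel g i k b a x.
Proof.
move=> ix; congr (_ * _); apply: eq_bigr => l _; congr (_ * _).
rewrite [X in X - _]addrC; congr (_ - _); apply: near_eq_derive.
have : nbhs x (cimg i) by apply: open_nbhs_nbhs; split=> //; exact: cimg_open.
apply: (@filterS _ _ (nbhs_filter x)) => y iy.
by rewrite -[in LHS](gcoef_sym g iy) mxE.
Qed.

(** The bilinear form of the Christoffel symbols, and its derivative with
    respect to the point in the direction r. All tensor identities are checked
    in terms of these two. *)
Definition chr x p q : 'rV[R]_n := \row_(k < n) \sum_(a < n) \sum_(b < n)
  christoffel g i k a b x * p 0 a * q 0 b.

Definition dchr x r p q : 'rV[R]_n := \row_(k < n) \sum_(a < n) \sum_(b < n)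
  (\sum_(c < n) r 0 c * pderiv c (christoffel g i k a b) x) * p 0 a * q 0 b.

Lemma chrC x p q : cimg i x -> chr x p q = chr x q p.
Proof.
move=> ix; apply/rowP => k; rewrite !mxE exchange_big/=.
apply: eq_bigr => b _; apply: eq_bigr => a _.
by rewrite christoffelC// mulrAC.
Qed.

Lemma dchrC x r p q : cimg i x -> dchr x r p q = dchr x r q p.
Proof.
move=> ix; apply/rowP => k; rewrite !mxE exchange_big/=.
apply: eq_bigr => b _; apply: eq_bigr => a _; rewrite mulrAC.
have sum_eq (f h : 'I_n -> R) s t : (forall c, f c = h c) ->
    (\sum_c r 0 c * f c) * s * t = (\sum_c r 0 c * h c) * s * t.
  by move=> fh; congr (_ * _ * _); apply: eq_bigr => c _; rewrite fh.
apply: (sum_eq (fun c => pderiv c _ x) (fun c => pderiv c _ x)) => c.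
apply: near_eq_derive.
have : nbhs x (cimg i) by apply: open_nbhs_nbhs; split=> //; exact: cimg_open.
by apply: (@filterS _ _ (nbhs_filter x)) => y iy; exact: christoffelC.
Qed.

Lemma chrDr x p q r : chr x p (q + r) = chr x p q + chr x p r.
Proof.
apply/rowP => k; rewrite !mxE -big_split; apply: eq_bigr => a _.
by rewrite -big_split; apply: eq_bigr => b _; rewrite mxE mulrDr.
Qed.

Lemma chrNl x p q : chr x (- p) q = - chr x p q.
Proof.
apply/rowP => k; rewrite !mxE -sumrN; apply: eq_bigr => a _.
by rewrite -sumrN; apply: eq_bigr => b _; rewrite mxE mulrN mulNr.
Qed.

Lemma is_derive_chr (x p q : R -> 'rV[R]_n) (x' p' q' : 'rV[R]_n) (t : R) :
  cimg i (x t) -> is_derive t 1 x x' -> is_derive t 1 p p' ->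
  is_derive t 1 q q' ->
  is_derive t 1 (fun s => chr (x s) (p s) (q s))
    (dchr (x t) x' (p t) (q t) + chr (x t) p' (q t) + chr (x t) (p t) q').
Proof.
move=> ix dx /is_derive_mxP dp /is_derive_mxP dq.
apply/is_derive_mxP => k0 k; rewrite ord1 {k0}.
have -> : (fun s => chr (x s) (p s) (q s) 0 k : R^o) = fun s =>
    \sum_(a < n) \sum_(b < n)
      christoffel g i k a b (x s) * p s 0 a * q s 0 b.
  by apply/funext => s; rewrite mxE.
rewrite !mxE -!big_split/=; apply: is_derive_sumr => a.
rewrite -!big_split/=; apply: is_derive_sumr => b.
have dG : differentiable (christoffel g i k a b : _ -> R^o) (x t).
  exact: (christoffel_smooth k a b 1).1.
have := is_derive_diff_comp dG dx; rewrite derive_pderiv// => dGx.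
apply: (is_derive_eq (is_deriveM (is_deriveM dGx (dp 0 a)) (dq 0 b))).
have leibniz (G S pa pa' qb qb' : R) : G * pa * qb' + qb * (G * pa' + pa * S) =
    S * pa * qb + G * pa' * qb + G * pa * qb' by ring.
exact: leibniz.
Qed.

End Christoffel.

(** The identity behind [curvature_chr]. It is a rearrangement of sums, valid for
    arbitrary coefficients: D a b c stands for the derivative of Gamma_bc in the
    direction a, G and H for components of Gamma itself. *)
Lemma curvature_sums (R : comNzRingType) (n : nat) (D H : 'I_n -> 'I_n -> 'I_n -> R)
    (G : 'I_n -> 'I_n -> R) (X Y Z : 'I_n -> R) :
  \sum_a \sum_b \sum_c (D a b c - D b a c
     + \sum_m (G a m * H m b c - G b m * H m a c)) * X a * Y b * Z c =
  \sum_b \sum_c (\sum_a X a * D a b c) * Y b * Z c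
  - \sum_a \sum_c (\sum_b Y b * D b a c) * X a * Z c
  + \sum_a \sum_m G a m * X a * (\sum_b \sum_c H m b c * Y b * Z c)
  - \sum_b \sum_m G b m * Y b * (\sum_a \sum_c H m a c * X a * Z c).
Proof.
have d1 : \sum_b \sum_c (\sum_a X a * D a b c) * Y b * Z c =
    \sum_a \sum_b \sum_c D a b c * X a * Y b * Z c.
  rewrite [RHS]exchange_big/=; apply: eq_bigr => b _.
  rewrite [RHS]exchange_big/=; apply: eq_bigr => c _.
  by rewrite !mulr_suml; apply: eq_bigr => a _; rewrite (mulrC (X a)).
have d2 : \sum_a \sum_c (\sum_b Y b * D b a c) * X a * Z c =
    \sum_a \sum_b \sum_c D b a c * X a * Y b * Z c.
  apply: eq_bigr => a _; rewrite [RHS]exchange_big/=; apply: eq_bigr => c _.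
  by rewrite !mulr_suml; apply: eq_bigr => b _; ring.
have d3 : \sum_a \sum_m G a m * X a * (\sum_b \sum_c H m b c * Y b * Z c) =
    \sum_a \sum_b \sum_c (\sum_m G a m * H m b c) * X a * Y b * Z c.
  apply: eq_bigr => a _; under eq_bigr do rewrite mulr_sumr.
  rewrite exchange_big/=; apply: eq_bigr => b _.
  under eq_bigr do rewrite mulr_sumr.
  rewrite exchange_big/=; apply: eq_bigr => c _.
  by rewrite !mulr_suml; apply: eq_bigr => m _; ring.
have d4 : \sum_b \sum_m G b m * Y b * (\sum_a \sum_c H m a c * X a * Z c) =
    \sum_a \sum_b \sum_c (\sum_m G b m * H m a c) * X a * Y b * Z c.
  rewrite [RHS]exchange_big/=.
  apply: eq_bigr => b _; under eq_bigr do rewrite mulr_sumr.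
  rewrite exchange_big/=; apply: eq_bigr => a _.
  under eq_bigr do rewrite mulr_sumr.
  rewrite exchange_big/=; apply: eq_bigr => c _.
  by rewrite !mulr_suml; apply: eq_bigr => m _; ring.
rewrite d1 d2 d3 d4 -!sumrN -!big_split/=; apply: eq_bigr => a _.
rewrite -!sumrN -!big_split/=; apply: eq_bigr => b _.
rewrite -!sumrN -!big_split/=; apply: eq_bigr => c _.
by rewrite sumrB; ring.
Qed.
Lemma curvature_chr (R : realType) (n : nat) (M : topologicalType)
    (A : smooth_structure R n M) (g : riemannian_metric A) (i : chart A)
    (p : M) (X Y Z : tvec A) :
  let x := coord i p in
  curvature g p X Y Z i =
    dchr g i x (X i) (Y i) (Z i) - dchr g i x (Y i) (X i) (Z i)
    + chr g i x (X i) (chr g i x (Y i) (Z i))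
    - chr g i x (Y i) (chr g i x (X i) (Z i)).
Proof.
move=> x; apply/rowP => k; rewrite !mxE.
have := curvature_sums
  (fun a b c => pderiv a (christoffel g i k b c) x)
  (fun m a b => christoffel g i m a b x) (fun a m => christoffel g i k a m x)
  (fun a => X i 0 a) (fun a => Y i 0 a) (fun a => Z i 0 a).
rewrite /curvature_coef => ->.
congr (_ - _ + _ - _).
  by apply: eq_bigr => a _; apply: eq_bigr => m _; rewrite mxE.
by apply: eq_bigr => a _; apply: eq_bigr => m _; rewrite mxE.
Qed.

Lemma covD_chr (R : realType) (n : nat) (M : topologicalType)
    (A : smooth_structure R n M) (g : riemannian_metric A) (i : chart A)
    (c : R -> M) (V : R -> tvec A) (t : R) :
  covD g c V t i =
    derive1 (V ^~ i) t + chr g i (coord i (c t)) (velocity A c t i) (V t i).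
Proof. by []. Qed.

Lemma is_derive1 (R : realType) (V : normedModType R) (f : R -> V) (t : R) :
  derivable f t 1 -> is_derive t 1 f (derive1 f t).
Proof. by move=> df; rewrite derive1E; exact: derivableP. Qed.

Lemma is_derive_derive1 (R : realType) (V : normedModType R) (f : R -> V)
    (t : R) (v : V) :
  is_derive t 1 f v -> derive1 f t = v.
Proof. by move=> [_ <-]; rewrite derive1E. Qed.

Lemma smooth_at_derive (R : realType) (V : normedModType R) (f : R -> V)
    (t : R) :
  smooth_at f t -> is_derive t 1 f (derive1 f t).
Proof.
by move=> sf; apply: is_derive1; exact: (nbhs_singleton sf 0%N).
Qed.

Lemma smooth_at_derive2 (R : realType) (V : normedModType R) (f : R -> V)
    (t : R) :
  smooth_at f t -> is_derive t 1 (derive1 f) (derive1 (derive1 f) t).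
Proof.
by move=> sf; apply: is_derive1; exact: (nbhs_singleton sf 1%N).
Qed.

Lemma is_derive_row_mx (R : realType) (V : normedModType R) (p q : nat)
    (f : V -> 'rV[R]_p) (h : V -> 'rV[R]_q) (t w : V) f' h' :
  is_derive t w f f' -> is_derive t w h h' ->
  is_derive t w (fun s => row_mx (f s) (h s)) (row_mx f' h').
Proof.
move=> /is_derive_mxP df /is_derive_mxP dh; apply/is_derive_mxP => i k.
rewrite ord1; case: (splitP k) => j kj.
  have -> : k = lshift q j by apply/val_inj.
  rewrite row_mxEl (_ : (fun s => _) = fun s => f s 0 j); first exact: df.
  by apply/funext => s; rewrite row_mxEl.
have -> : k = rshift p j by apply/val_inj.
rewrite row_mxEr (_ : (fun s => _) = fun s => h s 0 j); first exact: dh.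
by apply/funext => s; rewrite row_mxEr.
Qed.

Lemma is_derive_lsubmx (R : realType) (V : normedModType R) (p q : nat)
    (c : V -> 'rV[R]_(p + q)) (t w : V) v :
  is_derive t w c v -> is_derive t w (fun s => lsubmx (c s)) (lsubmx v).
Proof.
move=> /is_derive_mxP dc; apply/is_derive_mxP => i k; rewrite mxE.
by rewrite (_ : (fun s => _) = fun s => c s i (lshift q k))//;
  apply/funext => s; rewrite mxE.
Qed.

Lemma is_derive_rsubmx (R : realType) (V : normedModType R) (p q : nat)
    (c : V -> 'rV[R]_(p + q)) (t w : V) v :
  is_derive t w c v -> is_derive t w (fun s => rsubmx (c s)) (rsubmx v).
Proof.
move=> /is_derive_mxP dc; apply/is_derive_mxP => i k; rewrite mxE.
by rewrite (_ : (fun s => _) = fun s => c s i (rshift p k))//;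
  apply/funext => s; rewrite mxE.
Qed.

Section GeodesicFlow.
Context (R : realType) (n : nat) (M : topologicalType).
Context (A : smooth_structure R n M) (g : riemannian_metric A) (i : chart A).

(** The geodesic spray: z is a position followed by a velocity. *)
Definition geodesic_field (z : 'rV[R]_(n + n)) : 'rV[R]_(n + n) :=
  row_mx (rsubmx z) (- chr g i (lsubmx z) (rsubmx z) (rsubmx z)).

Definition phase_domain : set 'rV[R]_(n + n) := [set z | cimg i (lsubmx z)].

Lemma open_phase_domain : open phase_domain.
Proof.
apply: (@open_comp _ _ (lsubmx : 'rV[R]_(n + n) -> _) (cimg i)).
  by move=> z _; exact/differentiable_continuous/differentiable_lsubmx.
exact: cimg_open.
Qed.

Lemma geodesic_field_smooth (k : 'I_(n + n)) (m : nat) :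
  Ck_on m phase_domain (fun z => geodesic_field z 0 k : R^o).
Proof.
have Uo := open_phase_domain.
case: (splitP k) => j kj.
  have -> : k = lshift n j by exact: val_inj.
  have sm : Ck_on m phase_domain (fun z => z 0 (rshift n j) : R^o).
    exact: Ck_on_coord.
  by apply: (Ck_on_ext Uo _ sm) => z _; rewrite row_mxEl mxE.
have -> : k = rshift n j by exact: val_inj.
have sm : Ck_on m phase_domain (fun z => - \sum_(a < n) \sum_(b < n)
    christoffel g i j a b (lsubmx z) * z 0 (rshift n a) * z 0 (rshift n b) : R^o).
  apply: Ck_onN => //; apply: Ck_on_sum => // a _; apply: Ck_on_sum => // b _.
  apply: Ck_onM => //; last exact: Ck_on_coord.
  apply: Ck_onM => //; last exact: Ck_on_coord.
  apply: Ck_on_lsubmx; [exact: cimg_open|exact: christoffel_smooth].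
apply: (Ck_on_ext Uo _ sm) => z _; rewrite row_mxEr !mxE; congr (- _).
by apply: eq_bigr => a _; apply: eq_bigr => b _; rewrite !mxE.
Qed.

(** Obtained by differentiating the spray along the line z + s w. *)
Lemma geodesic_field_jac (z w : 'rV[R]_(n + n)) :
  phase_domain z ->
  w *m jac geodesic_field z = row_mx (rsubmx w)
    (- (dchr g i (lsubmx z) (lsubmx w) (rsubmx z) (rsubmx z)
        + chr g i (lsubmx z) (rsubmx w) (rsubmx z)
        + chr g i (lsubmx z) (rsubmx z) (rsubmx w))).
Proof.
move=> iz.
have dline := is_derive_line z w 0.
have z0 : z + 0 *: w = z by rewrite scale0r addr0.
have dl := is_derive_lsubmx dline; have dr := is_derive_rsubmx dline.
have iz0 : cimg i (lsubmx (z + 0 *: w)) by rewrite z0.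
have := is_derive_chr g iz0 dl dr dr; rewrite z0 => dc.
have dN := is_deriveN dc.
have := is_derive_row_mx dr dN => /is_derive_mxP drow.
apply/rowP => k; apply: is_derive_unique (drow 0 k).
have dk : differentiable (fun x => geodesic_field x 0 k : R^o) (z + 0 *: w).
  by rewrite z0; exact: (geodesic_field_smooth k 1).1.
have dkw := is_derive_diff_comp dk dline.
rewrite derive_pderiv// z0 in dkw.
have -> : (w *m jac geodesic_field z) 0 k =
    \sum_(j < n + n) w 0 j * pderiv j (fun x => geodesic_field x 0 k) z.
  by rewrite mxE; apply: eq_bigr => j _; rewrite [jac _ _ _ _]mxE.
exact: dkw.
Qed.

End GeodesicFlow.

(** * Jacobi fields as solutions of the linearized geodesic flow *)

Lemma is_derive_jac_comp (R : realType) (N : nat) (F : 'rV[R]_N -> 'rV[R]_N)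
    (X : R -> 'rV[R]_N) (t : R) (X' : 'rV[R]_N) :
  (forall k, differentiable (fun z => F z 0 k : R^o) (X t)) ->
  is_derive t 1 X X' ->
  is_derive t 1 (fun s => F (X s)) (X' *m jac F (X t)).
Proof.
move=> dF dX; apply/is_derive_mxP => i k; rewrite ord1 {i}.
have := is_derive_diff_comp (dF k) dX; rewrite derive_pderiv// => dFk.
rewrite mxE; under eq_bigr do rewrite [jac _ _ _ _]mxE.
exact: dFk.
Qed.

Section Curves.
Context (R : realType) (n : nat) (M : topologicalType).
Context (A : smooth_structure R n M) (g : riemannian_metric A).
Implicit Types (i : chart A) (c : R -> M) (V W : R -> tvec A).

Lemma near_cdom i c (t : R) :
  {for t, continuous c} -> cdom i (c t) -> \forall s \near t, cdom i (c s).
Proof.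
move=> cc ict; apply: cc; apply: open_nbhs_nbhs; split=> //; exact: cdom_open.
Qed.

Definition phase i c (u : R) : 'rV[R]_(n + n) :=
  row_mx (coord i (c u)) (velocity A c u i).

Definition field_phase i V (u : R) : 'rV[R]_(n + n) :=
  row_mx (V u i) (derive1 (V ^~ i) u).

Lemma phase_in_domain i c u : cdom i (c u) -> phase_domain i (phase i c u).
Proof. by move=> iu; rewrite /phase_domain /= row_mxKl; exists (c u). Qed.

Lemma is_derive_coord i c t :
  smooth_curve_at A c t -> cdom i (c t) ->
  is_derive t 1 (fun s => coord i (c s)) (velocity A c t i).
Proof. by move=> [_ sc] /sc; exact: smooth_at_derive. Qed.

Lemma is_derive_velocity i c t :
  smooth_curve_at A c t -> cdom i (c t) ->
  is_derive t 1 (fun s => velocity A c s i) (derive1 (velocity A c ^~ i) t).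
Proof. by move=> [_ sc] /sc; exact: smooth_at_derive2. Qed.

Lemma geodesic_eq i c t : geodesic g c -> cdom i (c t) ->
  derive1 (velocity A c ^~ i) t =
  - chr g i (coord i (c t)) (velocity A c t i) (velocity A c t i).
Proof. by move=> /(_ t)[_ /[apply]]; rewrite covD_chr => /eqP; rewrite addr_eq0 => /eqP. Qed.

Lemma is_derive_phase i c t : geodesic g c -> cdom i (c t) ->
  is_derive t 1 (phase i c) (geodesic_field g i (phase i c t)).
Proof.
move=> gc it; have [sc _] := gc t.
have := is_derive_row_mx (is_derive_coord sc it) (is_derive_velocity sc it).
by rewrite (geodesic_eq gc it) /geodesic_field row_mxKl row_mxKr.
Qed.

(** The equation of first variation of the geodesic flow along c, read in the
    chart i. *)
Definition solves_linearized i c V (t : R) : Prop :=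
  is_derive t 1 (field_phase i V)
    (field_phase i V t *m jac (geodesic_field g i) (phase i c t)).

(** Differentiate the geodesic equation once more: translating a geodesic in
    time is a variation through geodesics. *)
Lemma velocity_linearized i c t : geodesic g c -> cdom i (c t) ->
  solves_linearized i c (velocity A c) t.
Proof.
move=> gc it; have [sc _] := gc t.
have near_i := near_cdom sc.1 it.
have phaseE s : cdom i (c s) ->
    field_phase i (velocity A c) s = geodesic_field g i (phase i c s).
  move=> is_; rewrite /field_phase (geodesic_eq gc is_) /geodesic_field.
  by rewrite row_mxKl row_mxKr.
rewrite /solves_linearized phaseE//.
apply: (@near_eq_is_derive _ _ _ (fun s => geodesic_field g i (phase i c s))).
  by apply: filterS near_i => s /phaseE ->.
apply: is_derive_jac_comp (is_derive_phase gc it) => k.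
exact: (geodesic_field_smooth g i k 1).1 _ (phase_in_domain it).
Qed.

(** In coordinates D D V + R(V,v)v = 0 becomes
    V'' = - (d_V Gamma)(v,v) - Gamma(V',v) - Gamma(v,V'): replacing v' by
    - Gamma(v,v), the terms quadratic in Gamma cancel, and so do those with the
    derivative of Gamma in the direction v, by the symmetry of Gamma. *)
Lemma jacobi_linearized i c V t : geodesic g c -> jacobi_field g c V ->
  cdom i (c t) -> solves_linearized i c V t.
Proof.
move=> gc jV it; have [sc _] := gc t; have [[_ sV] jVt] := jV t.
have ix : cimg i (coord i (c t)) by exists (c t).
have dV := smooth_at_derive (sV i it); have d2V := smooth_at_derive2 (sV i it).
have dx := is_derive_coord sc it; have dv := is_derive_velocity sc it.
set x := coord i (c t) in ix *; set v := velocity A c t i in dx *.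
have dcov : is_derive t 1 (fun s => covD g c V s i)
    (derive1 (derive1 (V ^~ i)) t + (dchr g i x v v (V t i)
     + chr g i x (- chr g i x v v) (V t i) + chr g i x v (derive1 (V ^~ i) t))).
  rewrite (geodesic_eq gc it) in dv.
  exact: is_deriveD d2V (is_derive_chr g ix dx dv dV).
have := jVt i it; rewrite covD_chr (is_derive_derive1 dcov).
rewrite covD_chr curvature_chr -/x -/v.
set J := V t i; set J' := derive1 (V ^~ i) t; set J'' := derive1 _ t.
move=> eqJ; rewrite /solves_linearized geodesic_field_jac; last exact: phase_in_domain.
rewrite /field_phase /phase !row_mxKl !row_mxKr -/x -/v -/J -/J'.
suff <- : J'' = - (dchr g i x J v v + chr g i x J' v + chr g i x v J').
  exact: is_derive_row_mx dV d2V.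
apply/eqP; rewrite -addr_eq0; apply/eqP; apply: etrans eqJ.
rewrite chrDr chrNl (dchrC g v v J ix) (chrC g J (chr g i x v v) ix).
rewrite (chrC g J' v ix) (chrC g J v ix).
move: (chr g i x v (chr g i x v J)) (chr g i x (chr g i x v v) J) => a b.
move: (chr g i x v J') (dchr g i x v J v) (dchr g i x J v v) => d e f.
by apply/rowP => k; rewrite !mxE; ring.
Qed.

End Curves.

(** * Change of chart for a variation of geodesics *)

Lemma is_derive_pushforward (R : realType) (n : nat) (U : set 'rV[R]_n)
    (f : 'rV[R]_n -> R^o) (x w : R -> 'rV[R]_n) (x' w' : 'rV[R]_n) (t : R) :
  Ck_on 2 U f -> U (x t) -> is_derive t 1 x x' -> is_derive t 1 w w' ->
  is_derive t 1 (fun s => \sum_(a < n) w s 0 a * pderiv a f (x s) : R^o)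
    (\sum_(a < n) w' 0 a * pderiv a f (x t)
     + \sum_(a < n) \sum_(b < n) w t 0 a * x' 0 b * pderiv b (pderiv a f) (x t)).
Proof.
move=> [_ f2] Ux dx /is_derive_mxP dw.
rewrite -big_split/=; apply: is_derive_sumr => a.
have dfa : differentiable (pderiv a f : _ -> R^o) (x t) by exact: (f2 _).1.
have := is_derive_diff_comp dfa dx; rewrite derive_pderiv// => dfx.
apply: (is_derive_eq (is_deriveM (dw 0 a) dfx)).
rewrite [in RHS]addrC; congr (_ + _); last exact: mulrC.
rewrite [LHS]mulr_sumr; apply: eq_bigr => b _; exact: mulrA.
Qed.

Lemma pderivC (R : realType) (n : nat) (U : set 'rV[R]_n)
    (f : 'rV[R]_n -> R^o) (x : 'rV[R]_n) (a b : 'I_n) :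
  open U -> U x -> Ck_on 2 U f ->
  pderiv b (pderiv a f) x = pderiv a (pderiv b f) x.
Proof. by move=> Uo Ux f2; exact: derive_sym Uo Ux f2. Qed.

Section ChartChange.
Context (R : realType) (n : nat) (M : topologicalType).
Context (A : smooth_structure R n M).
Implicit Types (i j : chart A) (c : R -> M) (V : R -> tvec A).

Definition overlap i j : set 'rV[R]_n := coord i @` (cdom i `&` cdom j).

Definition transition i j (k : 'I_n) (x : 'rV[R]_n) : R^o :=
  coord j (cinv i x) 0 k.

Lemma open_overlap i j : open (overlap i j).
Proof.
rewrite openE => _ [p [ip jp] <-]; rewrite /interior.
have ni : nbhs (coord i p) (cimg i).
  by apply: open_nbhs_nbhs; split; [exact: cimg_open|exists p].
have ci : cinv i @ coord i p --> cinv i (coord i p).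
  by apply: cinv_continuous; exists p.
have nj : nbhs (cinv i (coord i p)) (cdom j).
  by rewrite coordK//; apply: open_nbhs_nbhs; split=> //; exact: cdom_open.
have := @filterI _ _ (nbhs_filter (coord i p)) _ _ ni (ci _ nj).
apply: (@filterS _ _ (nbhs_filter (coord i p))) => _ [[q iq <-]].
by rewrite /= coordK// => jq; exists q.
Qed.

Lemma overlap_coord i j p : cdom i p -> cdom j p -> overlap i j (coord i p).
Proof. by move=> ip jp; exists p. Qed.

Lemma transitionE i j p k : cdom i p -> transition i j k (coord i p) = coord j p 0 k.
Proof. by move=> ip; rewrite /transition coordK. Qed.

Lemma smooth_transition i j k m : Ck_on m (overlap i j) (transition i j k).
Proof.
apply: Ck_on_mxcoord; first exact: open_overlap.
exact: transition_smooth.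
Qed.

(** The transformation rule of tangent vectors, in components: it becomes
    a sum to which the rules for derivatives along curves apply. *)
Lemma is_tangentP p (v : tvec A) :
  is_tangent p v <-> forall i j, cdom i p -> cdom j p -> forall k,
    v j 0 k = \sum_(a < n) v i 0 a * pderiv a (transition i j k) (coord i p).
Proof.
have E i j : cdom i p -> cdom j p -> forall k,
    ('d (coord j \o cinv i) (coord i p) (v i)) 0 k =
    \sum_(a < n) v i 0 a * pderiv a (transition i j k) (coord i p).
  move=> ip jp k; have ijx := overlap_coord ip jp.
  have d1 : differentiable (coord j \o cinv i) (coord i p).
    exact: (transition_smooth i j 1).1.
  rewrite -deriveE// derive_mx ?mxE; last exact: diff_derivable.
  by rewrite -derive_pderiv//; exact: (smooth_transition i j k 1).1.
split=> H i j ip jp.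
  by move=> k; rewrite (H i j ip jp) E.
by apply/rowP => k; rewrite E// (H i j).
Qed.

Lemma velocity_tangent c t :
  smooth_curve_at A c t -> is_tangent (c t) (velocity A c t).
Proof.
move=> sc; apply/is_tangentP => i j it jt k.
have dj := (is_derive_mxP _ _ _ _).1 (is_derive_coord sc jt) 0 k.
apply: is_derive_unique dj _.
have ijx := overlap_coord it jt.
have dT : differentiable (transition i j k) (coord i (c t)).
  exact: (smooth_transition i j k 1).1.
have := is_derive_diff_comp dT (is_derive_coord sc it).
rewrite derive_pderiv//; apply: near_eq_is_derive.
by apply: filterS (near_cdom sc.1 it) => s /transitionE ->.
Qed.

End ChartChange.
Section Variation.
Context (R : realType) (n : nat) (M : topologicalType).
Context (A : smooth_structure R n M).
Implicit Types (i j : chart A) (c : R -> M) (V : R -> tvec A).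

(** The regularity of a field along a curve on which a change of chart depends;
    unlike smoothness it is immediate for linear combinations. *)
Definition regular_field c V (t : R) : Prop :=
  (\forall s \near t, is_tangent (c s) (V s)) /\
  (forall i, cdom i (c t) -> derivable (V ^~ i) t 1).

Lemma derive_field_transition i j c V t k :
  smooth_curve_at A c t -> regular_field c V t ->
  cdom i (c t) -> cdom j (c t) ->
  derive1 (V ^~ j) t 0 k =
    \sum_(a < n) derive1 (V ^~ i) t 0 a * pderiv a (transition i j k) (coord i (c t))
    + \sum_(a < n) \sum_(b < n) V t i 0 a * velocity A c t i 0 b *
        pderiv b (pderiv a (transition i j k)) (coord i (c t)).
Proof.
move=> sc [tV dV] it jt.
have dVj := (is_derive_mxP _ _ _ _).1 (is_derive1 (dV j jt)) 0 k.
apply: is_derive_unique dVj _.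
have := is_derive_pushforward (smooth_transition i j k 2) (overlap_coord it jt)
  (is_derive_coord sc it) (is_derive1 (dV i it)).
apply: near_eq_is_derive; near=> s.
have is_ : cdom i (c s) by near: s; exact: near_cdom sc.1 it.
have js : cdom j (c s) by near: s; exact: near_cdom sc.1 jt.
have ts : is_tangent (c s) (V s) by near: s.
by rewrite ((is_tangentP _ _).1 ts i j is_ js).
Unshelve. all: by end_near. Qed.

(** Besides the positions this records the velocities, the other half of the
    initial data of a geodesic: only then can the derivative at one time
    determine those at later times. *)
Definition variation_at i (lam : R -> R -> M) V (s0 u : R) : Prop :=
  is_derive s0 1 (fun s => phase i (lam s) u) (field_phase i V u).

(** For the positions this is the chain rule. The derivative of the velocities
    in the chart j contains the second derivative of the transition map applied
    to the velocity and to V, and that of V in the chart j contains the same with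
    the two vectors exchanged, so both agree by Schwarz's theorem. *)
Lemma variation_at_chart i j (lam : R -> R -> M) V (s0 u : R) :
  {for s0, continuous (lam ^~ u)} ->
  (\forall s \near s0, smooth_curve_at A (lam s) u) ->
  regular_field (lam s0) V u ->
  cdom i (lam s0 u) -> cdom j (lam s0 u) ->
  variation_at i lam V s0 u -> variation_at j lam V s0 u.
Proof.
move=> cl sl rV iu ju vi.
have scl := nbhs_singleton sl.
have tV := nbhs_singleton rV.1.
have ni := near_cdom cl iu; have nj := near_cdom cl ju.
have dx := is_derive_lsubmx vi; have dv := is_derive_rsubmx vi.
have lE i' : (fun s => lsubmx (phase i' (lam s) u)) = fun s => coord i' (lam s u).
  by apply/funext => s; rewrite row_mxKl.
have rE i' : (fun s => rsubmx (phase i' (lam s) u)) = fun s => velocity A (lam s) u i'.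
  by apply/funext => s; rewrite row_mxKr.
rewrite lE row_mxKl in dx; rewrite rE row_mxKr in dv.
have ijx := overlap_coord iu ju.
apply: is_derive_row_mx; apply/is_derive_mxP => r k; rewrite (ord1 r) {r}.
  have dT : differentiable (transition i j k) (coord i (lam s0 u)).
    exact: (smooth_transition i j k 1).1.
  have := is_derive_diff_comp dT dx; rewrite derive_pderiv//.
  rewrite ((is_tangentP _ _).1 tV i j iu ju); apply: near_eq_is_derive.
  by apply: filterS ni => s /transitionE ->.
rewrite (derive_field_transition k scl rV iu ju).
have T2 := smooth_transition i j k 2.
have := is_derive_pushforward T2 ijx dx dv.
rewrite (_ : \sum_a \sum_b velocity A (lam s0) u i 0 a * _ * _ = \sum_a \sum_b
    V u i 0 a * velocity A (lam s0) u i 0 b *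
    pderiv b (pderiv a (transition i j k)) (coord i (lam s0 u))); last first.
  rewrite exchange_big/=; apply: eq_bigr => b _; apply: eq_bigr => a _.
  rewrite (pderivC a b (@open_overlap _ _ _ _ i j) ijx T2).
  by rewrite (mulrC (velocity A (lam s0) u i 0 a)).
apply: near_eq_is_derive; near=> s.
have is_ : cdom i (lam s u) by near: s.
have js : cdom j (lam s u) by near: s.
have ss : smooth_curve_at A (lam s) u by near: s.
by rewrite ((is_tangentP _ _).1 (velocity_tangent ss) i j is_ js).
Unshelve. all: by end_near. Qed.

End Variation.

(** * Propagation of a variation along a geodesic *)

Lemma lsubmx_dist (R : realType) (n p : nat) (z w : 'rV[R]_(n + p)) :
  `|lsubmx z - lsubmx w| <= `|z - w|.
Proof.
apply: rV_norm_le => // k.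
by have := ler_coord_norm (z - w) (lshift p k); rewrite !mxE.
Qed.

Section LocalPropagation.
Context (R : realType) (n : nat) (M : topologicalType).
Context (A : smooth_structure R n M).
Implicit Types (i : chart A) (c : R -> M).

(** A curve cannot leave a chart while its coordinates stay in a closed ball
    inside the image of the chart: the ball corresponds to a compact, hence
    closed, subset of the manifold. *)
Lemma cdom_closed_in_ball i c (y0 : 'rV[R]_n) (r a b : R) :
  (forall y, `|y - y0| <= r -> cimg i y) -> a < b ->
  {for b, continuous c} ->
  (forall u, a <= u < b -> cdom i (c u) /\ `|coord i (c u) - y0| <= r) ->
  cdom i (c b).
Proof.
move=> ri ab cb cu.
pose K := [set y : 'rV[R]_n | `|y - y0| <= r].
have Kc : compact K.
  apply: bounded_closed_compact.
    exists (r + `|y0|); split; first exact: num_real.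
    move=> m rm y Ky; rewrite /= -[y](subrK y0) (le_trans (ler_normD _ _))//.
    by rewrite (le_trans _ (ltW rm))// lerD2r.
  rewrite (_ : K = (fun y => `|y - y0|) @^-1` [set z | z <= r])//.
  apply: closed_comp; last exact: closed_le.
  have cd : continuous (fun y : 'rV[R]_n => `|y - y0|).
    move=> y; apply: (@continuous_comp 'rV[R]_n 'rV[R]_n R (fun y => y - y0) (fun y => `|y|)).
      have cid : {for y, continuous (fun y : 'rV[R]_n => y)} by exact: cvg_id.
      have ccst : {for y, continuous (cst y0 : 'rV[R]_n -> 'rV[R]_n)}.
        exact: cst_continuous.
      exact: continuousB cid ccst.
    exact: norm_continuous.
  by move=> y _; exact: cd.
have cKc : compact (cinv i @` K).
  apply: continuous_compact Kc; apply: continuous_in_subspaceT => y.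
  by rewrite inE => /ri iy; exact: cinv_continuous.
have cKcl : closed (cinv i @` K) by apply: compact_closed cKc; exact: manifold_hausdorff A.
have inK u : a <= u < b -> (cinv i @` K) (c u).
  by move=> /cu[iu ur]; exists (coord i (c u)) => //; rewrite coordK.
have [y Ky <-] : (cinv i @` K) (c b).
  apply: cKcl => B Bcb; have /nbhs_normP[e /= e0 eB] := cb _ Bcb.
  pose u := Num.max a (b - e / 2).
  have ub : u < b by rewrite gt_max ab ltrBlDr ltrDl divr_gt0.
  have au : a <= u by rewrite le_max lexx.
  exists (c u); split; first by apply: inK; rewrite au.
  apply: eB => /=; rewrite gtr0_norm ?subr_gt0// ltrBlDr -ltrBlDl.
  rewrite (@lt_le_trans _ _ (b - e / 2))//; last by rewrite le_max lexx orbT.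
  by rewrite ltrD2l ltrN2 ltr_pdivrMr// ltr_pMr// ltr1n.
by have [q iq <-] := ri y Ky; rewrite coordK.
Qed.

Lemma continuous_from_chart (i : chart A) (f : R -> M) (t : R) :
  (\forall s \near t, cdom i (f s)) ->
  {for t, continuous (fun s => coord i (f s))} -> {for t, continuous f}.
Proof.
move=> nf cf; have it := nbhs_singleton nf.
have : (fun s => cinv i (coord i (f s))) @ t --> cinv i (coord i (f t)).
  apply: (@continuous_comp _ _ _ (fun s => coord i (f s)) (cinv i)) => //.
  by apply: cinv_continuous; exists (f t).
rewrite coordK// => H; apply: cvg_trans H; apply: near_eq_cvg.
by apply: filterS nf => s; exact: coordK.
Qed.

End LocalPropagation.
Lemma is_derive_coord_variation (R : realType) (n : nat) (M : topologicalType)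
    (A : smooth_structure R n M) (lam : R -> R -> M) (V : R -> tvec A)
    (s0 u : R) (i : chart A) :
  variation_at i lam V s0 u ->
  is_derive s0 1 (fun s => coord i (lam s u)) (V u i).
Proof.
move=> /is_derive_lsubmx; rewrite row_mxKl.
rewrite (_ : (fun s => lsubmx _) = fun s => coord i (lam s u))//.
by apply/funext => s; rewrite row_mxKl.
Qed.

Section Propagation.
Context (R : realType) (n : nat) (M : topologicalType).
Context (A : smooth_structure R n M) (g : riemannian_metric A).
Context (lam : R -> R -> M) (V : R -> tvec A) (s0 : R).
Hypothesis lam_geodesic : \forall s \near s0, geodesic g (lam s).
Hypothesis V_linearized : forall i u, cdom i (lam s0 u) ->
  solves_linearized g i (lam s0) V u.

(** Near u0 the geodesic lam s0 stays in the chart i, where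
    [ode_family_derivable] applies to the geodesic spray on a short interval. *)
Lemma local_propagation (i : chart A) (u0 : R) : cdom i (lam s0 u0) ->
  exists d : R, [/\ 0 < d,
    forall u, u0 - d <= u <= u0 + d -> cdom i (lam s0 u)
  & forall a b, u0 - d <= a -> a <= b -> b <= u0 + d ->
    (\forall s \near s0, cdom i (lam s a)) -> variation_at i lam V s0 a ->
    (\forall s \near s0, cdom i (lam s b)) /\ variation_at i lam V s0 b].
Proof.
move=> iu0.
have gs0 := nbhs_singleton lam_geodesic.
have [sc0 _] := gs0 u0.
have [x0 x0D cphase] : exists2 x0, phase_domain i x0 &
    phase i (lam s0) @ u0 --> x0.
  exists (phase i (lam s0) u0); first exact: phase_in_domain.
  exact: is_derive_continuous (is_derive_phase gs0 iu0).
have [C [FC Cdom]] : exists C : R, C2_bounds (geodesic_field g i) x0 C /\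
    forall p, `|p - lsubmx x0| <= C^-1 -> cimg i p.
  have nU : nbhs (lsubmx x0) (cimg i).
    by apply: open_nbhs_nbhs; split; [exact: cimg_open|exact: x0D].
  have [C1 C10 C1P] : exists2 C1 : R, 0 < C1 &
      forall p, `|p - lsubmx x0| < C1^-1 -> cimg i p.
    near (@pinfty_nbhs R) => C1; exists C1.
      by near: C1; apply: nbhs_pinfty_gt; exact: num_real.
    by near: C1; exact: (near_pinfty_ball nU).
  near (@pinfty_nbhs R) => C; exists C.
  have C0 : 0 < C by near: C; apply: nbhs_pinfty_gt; exact: num_real.
  split.
    split=> //; near: C.
    exact: C2_field_bounds (@open_phase_domain _ _ _ _ i) x0D
      (fun k => geodesic_field_smooth g i k 2).
  move=> p pC; apply: C1P; rewrite (le_lt_trans pC)// ltf_pV2//.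
  by near: C; apply: nbhs_pinfty_gt; exact: num_real.
have C0 := FC.1.
have C2 : 0 < C^-1 / 2 by rewrite divr_gt0 ?invr_gt0.
have /nbhs_normP[d1 /= d10 d1P] : nbhs u0 [set u | cdom i (lam s0 u) /\
    `|phase i (lam s0) u - x0| < C^-1 / 2].
  apply: filterI; first exact: near_cdom sc0.1 iu0.
  move/cvgrPdist_lt : cphase => /(_ _ C2); apply: filterS => u.
  by rewrite distrC.
(* An interval of length 2 d has length at most 1 / (2 C), as needed for the
   short Gronwall inequality. *)
pose d := Num.min (d1 / 2) ((4 * C)^-1).
have d0 : 0 < d by rewrite lt_min divr_gt0//= invr_gt0 mulr_gt0.
have dd1 : d < d1.
  by rewrite (@le_lt_trans _ _ (d1 / 2)) ?ge_min ?lexx// ltr_pdivrMr// ltr_pMr// ltr1n.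
have dC : d <= (4 * C)^-1 by rewrite ge_min lexx orbT.
have inball0 u : u0 - d <= u <= u0 + d -> cdom i (lam s0 u) /\
    `|phase i (lam s0) u - x0| < C^-1 / 2.
  move=> /andP[du ud]; apply: d1P => /=.
  by rewrite (le_lt_trans _ dd1)// ler_norml; apply/andP; split; lra.
exists d; split=> // [u /inball0[]//|a b ua ab bu na va].
have inball u : a <= u <= b -> cdom i (lam s0 u) /\
    `|phase i (lam s0) u - x0| < C^-1 / 2.
  by move=> /andP[au ub]; apply: inball0; rewrite (le_trans ua)// (le_trans ub).
have Cab : C * (b - a) <= 2^-1.
  have Cd : C * d <= 4^-1.
    by rewrite -ler_pdivlMl// mulrC -invfM.
  have : C * (b - a) <= C * (2 * d) by rewrite ler_wpM2l ?(ltW C0)//; lra.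
  lra.
have good : \forall s \near s0, [/\ cdom i (lam s a),
     forall u, a <= u <= b -> cdom i (lam s u) ->
       is_derive u 1 (phase i (lam s)) (geodesic_field g i (phase i (lam s) u)),
     forall u, a <= u <= b -> cdom i (lam s u) ->
       \forall u' \near u, cdom i (lam s u')
   & forall c, a < c -> c <= b ->
     (forall u, a <= u < c -> cdom i (lam s u) /\
        `|phase i (lam s) u - x0| < C^-1) -> cdom i (lam s c)].
  apply: filterS2 lam_geodesic na => s gs ia; split=> //.
  - by move=> u _ iu; exact: is_derive_phase gs iu.
  - by move=> u _ iu; exact: near_cdom (gs u).1.1 iu.
  - move=> c ac cb H; apply: (@cdom_closed_in_ball _ _ _ _ _ _ (lsubmx x0) _ _ _ Cdom ac).
      exact: (gs c).1.1.
    move=> u uac; have [iu ux] := H u uac; split=> //.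
    have := lsubmx_dist (phase i (lam s) u) x0; rewrite row_mxKl.
    by move=> /le_trans; apply; exact: ltW.
have bb : a <= b <= b by rewrite ab lexx.
exact: (ode_family_derivable FC Cab
  (fun u uab => is_derive_phase gs0 (inball u uab).1)
  (fun u uab => (inball u uab).2)
  (fun u uab => V_linearized (inball u uab).1) good va bb).
Unshelve. all: by end_near. Qed.

Hypothesis V_regular : forall u, regular_field (lam s0) V u.

(** Real induction on u. Each step takes place in a chart around the current
    point, reached by [variation_at_chart]. *)
Lemma global_propagation (i0 : chart A) :
  {for s0, continuous (lam ^~ 0)} -> cdom i0 (lam s0 0) ->
  variation_at i0 lam V s0 0 ->
  forall u, 0 <= u -> {for s0, continuous (lam ^~ u)} /\
    forall i, cdom i (lam s0 u) -> variation_at i lam V s0 u.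
Proof.
move=> c0 i00 v0 b b0.
pose P u := {for s0, continuous (lam ^~ u)} /\
  forall i, cdom i (lam s0 u) -> variation_at i lam V s0 u.
have sm u : \forall s \near s0, smooth_curve_at A (lam s) u.
  by apply: filterS lam_geodesic => s gs; exact: (gs u).1.
have all_charts i u : (\forall s \near s0, cdom i (lam s u)) ->
    variation_at i lam V s0 u -> P u.
  move=> ni vi; have iu := nbhs_singleton ni.
  have cu : {for s0, continuous (lam ^~ u)}.
    apply: (continuous_from_chart ni).
    exact: is_derive_continuous (is_derive_coord_variation vi).
  by split=> // j ju; exact: variation_at_chart cu (sm u) (V_regular u) iu ju vi.
apply: (@real_induction R P 0 b) => [|c ac cb Pc|c ac cb Pc|]; last by rewrite b0 lexx.
- by apply: all_charts v0; exact: near_cdom c0 i00.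
- have [cc vc] : P c by apply: Pc; rewrite ac lexx.
  have ic := chart_atP A (lam s0 c); set i := chart_at A (lam s0 c) in ic.
  have [d [d0 _ dP]] := local_propagation ic.
  exists (c + d) => [|x /andP[cx xd] _]; first by rewrite ltrDl.
  have [|||||nx vx] := dP c x.
  + by rewrite lerBlDr lerDl ltW.
  + exact: ltW.
  + exact: xd.
  + exact: near_cdom cc ic.
  + exact: vc.
  exact: all_charts nx vx.
- have ic := chart_atP A (lam s0 c); set i := chart_at A (lam s0 c) in ic.
  have [d [d0 di dP]] := local_propagation ic.
  pose a := Num.max 0 (c - d).
  have ac' : a < c by rewrite gt_max ac ltrBlDr ltrDl.
  have da : c - d <= a by rewrite le_max lexx orbT.
  have [ca va] : P a by apply: Pc; rewrite ac' le_max lexx.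
  have ia : cdom i (lam s0 a).
    by apply: di; rewrite da (le_trans (ltW ac'))// lerDl ltW.
  have [|||||nx vx] := dP a c.
  + exact: da.
  + exact: ltW.
  + by rewrite lerDl ltW.
  + exact: near_cdom ca ia.
  + exact: va.
  exact: all_charts nx vx.
Qed.

End Propagation.

(** * The variation of the poles *)

Section LinearFields.
Context (R : realType) (n : nat) (M : topologicalType).
Context (A : smooth_structure R n M) (g : riemannian_metric A).
Implicit Types (i : chart A) (c : R -> M) (V K : R -> tvec A).

Lemma chr0r i x p : chr g i x p 0 = 0.
Proof.
by apply/rowP => k; rewrite !mxE big1// => a _; rewrite big1// => b _; rewrite mxE mulr0.
Qed.

(** Reversing the direction of a geodesic does not change its equation; this is
    why pulled and pushed tractrices are treated alike. *)
Lemma chr_signs i x p q (eps : R) : eps * eps = 1 ->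
  chr g i x (eps *: p) (eps *: q) = chr g i x p q.
Proof.
move=> e2; apply/rowP => k; rewrite !mxE; apply: eq_bigr => a _.
apply: eq_bigr => b _; rewrite !mxE.
have signs (G y z : R) : G * (eps * y) * (eps * z) = eps * eps * (G * y * z) by ring.
by rewrite signs e2 mul1r.
Qed.

Lemma is_tangent_lin p (v w : tvec A) (a : R) :
  is_tangent p v -> is_tangent p w -> is_tangent p (fun i => a *: v i + w i).
Proof.
move=> /is_tangentP tv /is_tangentP tw; apply/is_tangentP => i j ip jp k.
rewrite !mxE (tv i j)// (tw i j)// mulr_sumr -big_split/=.
by apply: eq_bigr => b _; rewrite !mxE mulrDl mulrA.
Qed.

Lemma regular_field_lin c V K (a : R) t :
  regular_field c V t -> regular_field c K t ->
  regular_field c (fun s i => a *: V s i + K s i) t.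
Proof.
move=> [tV dV] [tK dK]; split.
  by apply: filterS2 tV tK => s; exact: is_tangent_lin.
by move=> i it; apply: derivableD; [apply: derivableZ; exact: dV|exact: dK].
Qed.

Lemma velocity_regular c t : geodesic g c -> regular_field c (velocity A c) t.
Proof.
move=> gc; split.
  by apply: (@filterE _ _ (nbhs_filter t)) => s; exact: velocity_tangent (gc s).1.
by move=> i it; have [] := is_derive_velocity (gc t).1 it.
Qed.

Lemma jacobi_regular c V t : jacobi_field g c V -> regular_field c V t.
Proof.
move=> jV; have [[tV sV] _] := jV t; split=> // i it.
by have [] := smooth_at_derive (sV i it).
Qed.

Lemma solves_linearized_lin i c V K (a : R) t :
  {for t, continuous c} -> cdom i (c t) ->
  (forall s, regular_field c V s) -> (forall s, regular_field c K s) ->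
  solves_linearized g i c V t -> solves_linearized g i c K t ->
  solves_linearized g i c (fun s i => a *: V s i + K s i) t.
Proof.
move=> cc it rV rK sV sK.
have phaseE s : cdom i (c s) -> field_phase i (fun s i => a *: V s i + K s i) s =
    a *: field_phase i V s + field_phase i K s.
  move=> is_; rewrite /field_phase scale_row_mx add_row_mx; congr (row_mx _ _).
  have dV := is_derive1 ((rV s).2 i is_); have dK := is_derive1 ((rK s).2 i is_).
  exact: is_derive_derive1 (is_deriveD (is_deriveZ a dV) dK).
rewrite /solves_linearized phaseE// mulmxDl -scalemxAl.
apply: (@near_eq_is_derive _ _ _ (fun s => a *: field_phase i V s + field_phase i K s)).
  by apply: filterS (near_cdom cc it) => s /phaseE ->.
exact: is_deriveD (is_deriveZ a sV) sK.
Qed.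

Lemma zero_regular c t : regular_field c (fun=> zero_tvec A) t.
Proof.
split; last by move=> i _; exact: derivable_cst.
apply: (@filterE _ _ (nbhs_filter t)) => s.
apply/is_tangentP => i j _ _ k; rewrite mxE big1// => a _.
by rewrite mxE mul0r.
Qed.

Lemma zero_linearized i c t : solves_linearized g i c (fun=> zero_tvec A) t.
Proof.
rewrite /solves_linearized.
have -> : field_phase i (fun=> zero_tvec A) = cst 0.
  apply/funext => s; rewrite /field_phase derive1_cst; exact: row_mx0.
by rewrite mul0mx; exact: is_derive_cst.
Qed.

End LinearFields.

Section Tractrix.
Context (R : realType) (n : nat) (M : topologicalType).
Context (A : smooth_structure R n M) (g : riemannian_metric A).
Context (eps : R) (eps2 : eps * eps = 1) (gam : R -> M) (lam : R -> R -> M).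
Context (s0 : R) (gam_smooth : smooth_curve_at A gam s0).
Hypothesis pole : \forall s \near s0, [/\ geodesic g (lam s), lam s 0 = gam s
  & eq_tvec (gam s) (velocity A (lam s) 0) (fun i => eps *: velocity A gam s i)].

(** The formula d_s r = eps d_u r + K for any K that solves the linearized
    equation with the initial data of the Jacobi field of the pole. It is stated
    for such K, and with the initial condition in one chart only, in order to be
    applied also to K = 0 when the geodesic curvature vanishes. *)
Lemma pole_variation (K : R -> tvec A) (i0 : chart A) :
  (forall u, regular_field (lam s0) K u) ->
  (forall i u, cdom i (lam s0 u) -> solves_linearized g i (lam s0) K u) ->
  cdom i0 (gam s0) -> K 0 i0 = 0 ->
  derive1 (K ^~ i0) 0 = eps *: covD g gam (velocity A gam) s0 i0 ->
  forall u, 0 <= u -> {for s0, continuous (lam ^~ u)} /\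
    forall i, cdom i (lam s0 u) ->
    is_derive s0 1 (fun s => coord i (lam s u))
      (eps *: velocity A (lam s0) u i + K u i).
Proof.
move=> rK sK ig K0 dK0.
have [gs0 lam0 vel0] := nbhs_singleton pole.
have i00 : cdom i0 (lam s0 0) by rewrite lam0.
pose V u (i : chart A) := eps *: velocity A (lam s0) u i + K u i.
have rv u := velocity_regular u gs0.
have rV u : regular_field (lam s0) V u by exact: regular_field_lin.
have sV i u : cdom i (lam s0 u) -> solves_linearized g i (lam s0) V u.
  move=> iu; apply: solves_linearized_lin => //; first exact: (gs0 u).1.1.
    exact: velocity_linearized.
  exact: sK.
have c0 : {for s0, continuous (lam ^~ 0)}.
  have cg : gam @ s0 --> gam s0 := gam_smooth.1.
  suff : lam ^~ 0 @ s0 --> lam s0 0 by [].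
  rewrite lam0; apply: cvg_trans cg; apply: near_eq_cvg.
  by apply: filterS pole => s [_ -> _].
have v0 : variation_at i0 lam V s0 0.
  have V0 : V 0 i0 = velocity A gam s0 i0.
    by rewrite /V vel0// K0 addr0 scalerA eps2 scale1r.
  have dV0 : derive1 (V ^~ i0) 0 = eps *: derive1 (velocity A gam ^~ i0) s0.
    have dv := is_derive1 ((rv 0).2 i0 i00).
    have dK := is_derive1 ((rK 0).2 i0 i00).
    rewrite (is_derive_derive1 (is_deriveD (is_deriveZ eps dv) dK)).
    rewrite (geodesic_eq gs0 i00) vel0// lam0 chr_signs// dK0 covD_chr.
    by rewrite scalerDr scalerN addrCA addNr addr0.
  rewrite /variation_at /field_phase V0 dV0.
  have dg := is_derive_row_mx (is_derive_coord gam_smooth ig)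
    (is_deriveZ eps (is_derive_velocity gam_smooth ig)).
  apply: near_eq_is_derive dg.
  apply: filterS2 pole (near_cdom gam_smooth.1 ig) => s [_ ls vs] is_.
  by rewrite /phase ls vs.
have gl : \forall s \near s0, geodesic g (lam s) by apply: filterS pole => s [].
move=> u u0; have [cu vu] := global_propagation gl sV rV c0 i00 v0 u0.
by split=> // i iu; exact: is_derive_coord_variation (vu i iu).
Qed.

End Tractrix.

(** * The metric as a quadratic form *)

Section Metric.
Context (R : realType) (n : nat) (M : topologicalType).
Context (A : smooth_structure R n M) (g : riemannian_metric A).
Implicit Types (p : M) (v w z : tvec A).

Lemma chart_at_img p : cimg (chart_at A p) (coord (chart_at A p) p).
Proof. by exists p => //; exact: chart_atP. Qed.

Lemma ginnerC p v w : ginner g p v w = ginner g p w v.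
Proof.
rewrite /ginner; set i := chart_at A p; set G := gcoef g i _.
have GT : G^T = G by exact: gcoef_sym (chart_at_img p).
have -> : v i *m G *m (w i)^T = (w i *m G *m (v i)^T)^T.
  by rewrite !trmx_mul trmxK GT mulmxA.
by rewrite mxE.
Qed.

Lemma ginner_linl p v w k z (a : R) :
  (forall i, cdom i p -> v i = a *: w i + k i) ->
  ginner g p v z = a * ginner g p w z + ginner g p k z.
Proof.
move=> vE; rewrite /ginner vE; last exact: chart_atP.
by rewrite !mulmxDl -!scalemxAl !mxE.
Qed.

Lemma ginner_ge0 p v : 0 <= ginner g p v v.
Proof.
rewrite /ginner; set i := chart_at A p.
have [->|v0] := eqVneq (v i) 0; first by rewrite !mul0mx mxE.
exact/ltW/(gcoef_pos g (chart_at_img p) v0).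
Qed.

Lemma ginner_eq0 p v : ginner g p v v = 0 -> v (chart_at A p) = 0.
Proof.
move=> vv0; apply/eqP; apply: contraT => v0.
by have := gcoef_pos g (chart_at_img p) v0; rewrite -/(ginner g p v v) vv0 ltxx.
Qed.

Lemma gnorm_sqr p v : gnorm g p v ^+ 2 = ginner g p v v.
Proof. by rewrite sqr_sqrtr// ginner_ge0. Qed.

Lemma gnorm_eq0 p v : gnorm g p v = 0 -> v (chart_at A p) = 0.
Proof. by move=> v0; apply: ginner_eq0; rewrite -gnorm_sqr v0 expr0n. Qed.

Lemma gnorm_zero p v : v (chart_at A p) = 0 -> gnorm g p v = 0.
Proof. by move=> v0; rewrite /gnorm /ginner v0 !mul0mx mxE sqrtr0. Qed.

Lemma ginner_pythagoras p v w k (eps : R) : eps * eps = 1 ->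
  (forall i, cdom i p -> v i = eps *: w i + k i) ->
  ginner g p w w = 1 -> ginner g p k w = 0 ->
  ginner g p v w = eps /\ ginner g p v v = 1 + gnorm g p k ^+ 2.
Proof.
move=> e2 vE w1 kw0; have vw : ginner g p v w = eps.
  by rewrite (ginner_linl _ vE) w1 mulr1 kw0 addr0.
split=> //; rewrite (ginner_linl _ vE) ginnerC vw e2; congr (_ + _).
by rewrite ginnerC (ginner_linl _ vE) [ginner g p w k]ginnerC kw0 mulr0 add0r gnorm_sqr.
Qed.

Lemma ginner_chart i p v w : cdom i p -> is_tangent p v -> is_tangent p w ->
  ginner g p v w = (v i *m gcoef g i (coord i p) *m (w i)^T) 0 0.
Proof.
move=> ip tv tw; rewrite /ginner.
by rewrite (@gcoef_tensor _ _ _ _ g _ i p v w (chart_atP A p) ip tv tw).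
Qed.

Lemma ginner_chart_sum i p v w : cdom i p -> is_tangent p v -> is_tangent p w ->
  ginner g p v w = \sum_(b < n) \sum_(a < n)
    v i 0 a * gcoef g i (coord i p) a b * w i 0 b.
Proof.
move=> ip tv tw; rewrite (ginner_chart ip)// mxE.
by apply: eq_bigr => b _; rewrite !mxE mulr_suml.
Qed.

End Metric.

(** * Measurability *)

(** Countably many intervals with rational ends, on each of which f is
    measurable, cover D. *)
Lemma measurable_fun_locally (R : realType) (D : set R) (f : R -> R) :
  measurable D ->
  (forall x, D x -> exists a b : R, [/\ a < x, x < b & measurable_fun `]a, b[ f]) ->
  measurable_fun D f.
Proof.
move=> mD loc.
pose J (pq : rat * rat) : set R := `]ratr pq.1, ratr pq.2[%classic.
pose E k : set R := if unpickle k is Some pq then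
  (if `[< measurable_fun (J pq) f >] then J pq else set0) else set0.
have mE k : measurable (E k).
  rewrite /E; case: unpickle => [pq|//]; case: ifP => // _.
  exact: measurable_itv.
have mfE k : measurable_fun (E k) f.
  rewrite /E; case: unpickle => [pq|]; last exact: measurable_fun_set0.
  by case: ifPn => [/asboolP//|_]; exact: measurable_fun_set0.
apply: (@measurable_funS _ _ _ _ (\bigcup_k E k)).
- exact: bigcup_measurable.
- move=> x /loc [a [b [ax xb mf]]].
  have [p] := rat_in_itvoo ax; rewrite in_itv/= => /andP[ap px].
  have [q] := rat_in_itvoo xb; rewrite in_itv/= => /andP[xq qb].
  have EJ : E (pickle (p, q)) = J (p, q).
    rewrite /E pickleK ifT//; apply/asboolP.
    apply: measurable_funS mf; first exact: measurable_itv.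
    move=> y; rewrite /J /= !in_itv/= => /andP[py yq].
    by rewrite (lt_trans ap py) (lt_trans yq qb).
  exists (pickle (p, q)); first exact: Logic.I.
  by rewrite EJ /J /= in_itv/= px.
- exact/measurable_fun_bigcup.
Qed.

(** The derivative is the limit of the difference quotients with step 1 / m.+1;
    f is first extended by zero, because its argument may leave the interval. *)
Lemma measurable_derive1 (R : realType) (a b : R) (f : R -> R) :
  (forall s, a < s < b -> derivable f s 1) ->
  measurable_fun `]a, b[ (derive1 f).
Proof.
move=> df; pose D : set R := `]a, b[%classic.
have mD : measurable D by exact: measurable_itv.
have mf : measurable_fun D f.
  apply: open_continuous_measurable_fun; first exact: interval_open.
  move=> s; rewrite inE /D /= in_itv/= => /df ds.
  exact/differentiable_continuous/derivable1_diffP.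
have mfD : measurable_fun setT (f \_ D) by exact: (measurable_restrictT f mD).1 mf.
pose h (m : nat) (s : R) := m.+1%:R * ((f \_ D) (s + m.+1%:R^-1) - (f \_ D) s).
apply: (@measurable_fun_cvg _ _ _ _ h).
  move=> m; apply: measurable_funTS; apply: measurable_funM => //.
  apply: measurable_funB => //.
  by apply: measurableT_comp => //; exact: measurable_funD.
move=> s Ds; have sab : a < s < b by move: Ds; rewrite /D /= in_itv.
apply/cvgrPdist_le => e e0.
have /is_derive_errorP /(_ e e0) err := is_derive1 (df s sab).
have nD : nbhs s D by apply: open_nbhs_nbhs; split=> //; exact: interval_open.
have hs : (fun m : nat => s + m.+1%:R^-1) @ \oo --> s.
  rewrite -[X in _ --> X]addr0; apply: cvgD; first exact: cvg_cst.
  exact: cvg_harmonic.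
near=> m.
have m0 : 0 < m.+1%:R :> R by rewrite ltr0n.
have Dm : D (s + m.+1%:R^-1) by near: m; exact: hs nD.
have : `|f (s + m.+1%:R^-1) - f s - (s + m.+1%:R^-1 - s) *: derive1 f s| <=
    e * `|s + m.+1%:R^-1 - s| by near: m; exact: hs err.
have -> : h m s = m.+1%:R * (f (s + m.+1%:R^-1) - f s).
  by rewrite /h !patchE !mem_set.
have k0 : 0 < m.+1%:R^-1 :> R by rewrite invr_gt0.
have kE : m.+1%:R = (m.+1%:R^-1)^-1 :> R by rewrite invrK.
rewrite [X in X * (f _ - _)]kE; move: (m.+1%:R^-1) k0 => k k0.
rewrite (addrC s) addrK (gtr0_norm k0) => errm.
have -> : derive1 f s - k^-1 * (f (k + s) - f s) =
    - (k^-1 * (f (k + s) - f s - k * derive1 f s)).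
  by rewrite [k^-1 * (_ - k * _)]mulrBr mulKf ?gt_eqF// opprB.
rewrite normrN normrM gtr0_norm ?invr_gt0// ler_pdivrMl// [k * e]mulrC.
exact: errm.
Unshelve. all: by end_near. Qed.

(** The function is the limit of those obtained by rounding u down to
    a multiple of 1 / m.+1, which are measurable on each strip between two
    consecutive multiples. *)
Lemma caratheodory_measurable (R : realType) (f : R -> R -> R) :
  (forall u, measurable_fun setT (f ^~ u)) -> (forall s, continuous (f s)) ->
  measurable_fun setT (fun z : R * R => f z.1 z.2).
Proof.
move=> mf cf.
pose grid (m : nat) (u : R) : R := (Num.floor (m.+1%:R * u))%:~R / m.+1%:R.
apply: (@measurable_fun_cvg _ _ _ _ (fun m (z : R * R) => f z.1 (grid m z.2))).
  move=> m.
  have m0 : 0 < m.+1%:R :> R by rewrite ltr0n.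
  pose E k : set (R * R) := if unpickle k is Some z then
    setT `*` `[z%:~R / m.+1%:R, (z + 1)%:~R / m.+1%:R[%classic else set0.
  have mE k : measurable (E k).
    rewrite /E; case: unpickle => [z|//].
    by apply: measurableX => //; exact: measurable_itv.
  have -> : [set: R * R] = \bigcup_k E k.
    apply/esym/seteqP; split=> // -[s u] _.
    exists (pickle (Num.floor (m.+1%:R * u))); first exact: Logic.I.
    rewrite /E pickleK; split; first exact: Logic.I.
    rewrite /=; rewrite in_itv/= ler_pdivrMr// ltr_pdivlMr// mulrC.
    exact: floor_itv.
  apply/measurable_fun_bigcup => // k; rewrite /E.
  case: unpickle => [z|]; last exact: measurable_fun_set0.
  apply: (@eq_measurable_fun _ _ _ _ _ (fun x : R * R => f x.1 (z%:~R / m.+1%:R))).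
    move=> [s u]; rewrite inE => -[_ /=]; rewrite in_itv/= => uz.
    rewrite /grid; congr (f _ (_%:~R / _)); apply/esym/floor_def.
    by rewrite mulrC -ler_pdivrMr// -ltr_pdivlMr.
  apply: measurable_funTS.
  by apply: (measurableT_comp (mf (z%:~R / m.+1%:R))); exact: measurable_fst.
move=> [s u] _ /=.
apply: (@cvg_comp _ _ _ (fun m => grid m u) (f s) _ (nbhs u)); last exact: cf.
apply/cvgrPdist_le => e e0.
near=> m.
have m0 : 0 < m.+1%:R :> R by rewrite ltr0n.
have : m.+1%:R^-1 <= e.
  near: m; have /cvgrPdist_le /(_ e e0) := @cvg_harmonic R.
  by apply: filterS => m'; rewrite sub0r normrN ger0_norm ?harmonic_ge0.
apply: le_trans.
rewrite -(ler_pM2r m0) mulVf ?gt_eqF// -[X in _ * X](gtr0_norm m0) -normrM.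
rewrite mulrBl /grid divfK ?gt_eqF// mulrC.
have /andP[f1 f2] := floor_itv (m.+1%:R * u).
rewrite ger0_norm ?subr_ge0// lerBlDr ltW// addrC.
by rewrite intrD in f2.
Unshelve. all: by end_near. Qed.

Section MetricAlongCurves.
Context (R : realType) (n : nat) (M : topologicalType).
Context (A : smooth_structure R n M) (g : riemannian_metric A).
Implicit Types (i : chart A) (c : R -> M) (V : R -> tvec A).

Lemma continuous_gcoef_curve i c (t : R) (a b : 'I_n) :
  {for t, continuous c} -> cdom i (c t) ->
  {for t, continuous (fun s => gcoef g i (coord i (c s)) a b)}.
Proof.
move=> cc it.
apply: (@continuous_comp _ _ _ (fun s => coord i (c s)) (fun x => gcoef g i x a b)).
  apply: (@continuous_comp _ _ _ c (coord i)) => //.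
  exact: coord_continuous it.
by apply: (gcoef_smooth g i a b 0); exists (c t).
Qed.

Lemma continuous_sumr (I : Type) (r : seq I) (f : I -> R -> R) (t : R) :
  (forall k, {for t, continuous (f k)}) ->
  {for t, continuous (fun s => \sum_(k <- r) f k s)}.
Proof.
move=> cf; elim: r => [|k r IH].
  rewrite (_ : (fun s => _) = cst 0); first exact: cst_continuous.
  by apply/funext => s; rewrite big_nil.
rewrite (_ : (fun s => _) = f k + (fun s => \sum_(j <- r) f j s)).
  exact: continuousD (cf k) IH.
by apply/funext => s; rewrite big_cons.
Qed.

(** [ginner] is computed in a chart that is selected point by point; the tensor
    property replaces it near t by one fixed chart. *)
Lemma continuous_ginner c V t :
  {for t, continuous c} -> regular_field c V t ->
  {for t, continuous (fun s => ginner g (c s) (V s) (V s))}.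
Proof.
move=> cc [tV dV]; pose i := chart_at A (c t).
have it : cdom i (c t) := chart_atP A (c t).
have ni := near_cdom cc it.
have nE : \forall s \near t, \sum_(b < n) \sum_(a < n)
    V s i 0 a * gcoef g i (coord i (c s)) a b * V s i 0 b = ginner g (c s) (V s) (V s).
  by apply: filterS2 ni tV => s is_ ts; rewrite (ginner_chart_sum g is_ ts ts).
have cE := nbhs_singleton nE.
have cVa (a : 'I_n) : {for t, continuous (fun s => V s i 0 a)}.
  have := (is_derive_mxP _ _ _ _).1 (is_derive1 (dV i it)) 0 a.
  exact: is_derive_continuous.
have cS : {for t, continuous (fun s => \sum_(b < n) \sum_(a < n)
    V s i 0 a * gcoef g i (coord i (c s)) a b * V s i 0 b)}.
  apply: continuous_sumr => b; apply: continuous_sumr => a.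
  apply: continuousM; last exact: cVa.
  by apply: continuousM; [exact: cVa|exact: continuous_gcoef_curve].
suff : (fun s => ginner g (c s) (V s) (V s)) @ t --> ginner g (c t) (V t) (V t) by [].
by rewrite -[X in _ --> X]cE; exact: cvg_trans (near_eq_cvg nE) cS.
Qed.

Lemma measurable_ginner_velocity c (a b : R) :
  (forall s, a < s < b -> [/\ {for s, continuous c},
     is_tangent (c s) (velocity A c s)
   & forall i, cdom i (c s) -> derivable (fun r => coord i (c r)) s 1]) ->
  measurable_fun `]a, b[
    (fun s => ginner g (c s) (velocity A c s) (velocity A c s)).
Proof.
move=> H; apply: measurable_fun_locally; first exact: measurable_itv.
move=> s0; rewrite /= in_itv/= => s0ab.
have [cc _ _] := H s0 s0ab; pose i := chart_at A (c s0).
have is0 : cdom i (c s0) := chart_atP A (c s0).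
have nab : nbhs s0 (`]a, b[%classic : set R).
  by apply: open_nbhs_nbhs; split; [exact: interval_open|rewrite /= in_itv].
have /nbhs_normP[e /= e0 eP] : nbhs s0 [set s | a < s < b /\ cdom i (c s)].
  apply: filterS2 nab (near_cdom cc is0) => s; rewrite /= in_itv/=; by split.
exists (s0 - e), (s0 + e); split; [by rewrite ltrBlDr ltrDl|by rewrite ltrDl|].
have inE' s : s0 - e < s < s0 + e -> a < s < b /\ cdom i (c s).
  move=> /andP[se es]; apply: eP => /=; rewrite ltr_norml; apply/andP; split; lra.
pose x (k : 'I_n) (s : R) : R := coord i (c s) 0 k.
have dx s k : s0 - e < s < s0 + e -> is_derive s 1 (x k) (velocity A c s i 0 k).
  move=> /inE'[sab is_]; have [_ _ /(_ i is_) ds] := H s sab.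
  exact: ((is_derive_mxP _ _ _ _).1 (is_derive1 ds) 0 k).
apply: (@eq_measurable_fun _ _ _ _ _ (fun s => \sum_(l < n) \sum_(k < n)
    derive1 (x k) s * gcoef g i (coord i (c s)) k l * derive1 (x l) s)).
  move=> s; rewrite inE/= in_itv/= => se; have [sab is_] := inE' s se.
  have [_ ts _] := H s sab; rewrite (ginner_chart_sum g is_ ts ts).
  apply: eq_bigr => l _; apply: eq_bigr => k _.
  by rewrite !(is_derive_derive1 (dx s _ se)).
have mx k : measurable_fun `](s0 - e), (s0 + e)[ (derive1 (x k)).
  by apply: measurable_derive1 => s se; have [] := dx s k se.
apply: measurable_sum => l; apply: measurable_sum => k.
apply: measurable_funM => //; apply: measurable_funM => //.
apply: open_continuous_measurable_fun; first exact: interval_open.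
move=> s; rewrite inE/= in_itv/= => /inE'[sab is_].
by apply: continuous_gcoef_curve is_; have [] := H s sab.
Qed.

End MetricAlongCurves.

(** * Lengths and areas swept by the poles *)

Section Poles.
Context (R : realType) (n : nat) (M : topologicalType).
Context (A : smooth_structure R n M) (g : riemannian_metric A).
Context (eps ell L : R) (T : set R) (eta gam : R -> M) (lam : R -> R -> M).
Context (JJ : R -> R -> tvec A).
Hypothesis eps2 : eps * eps = 1.
Hypothesis gam_tractrix : tractrix g eps ell T eta L gam lam.
Hypothesis JJ_jacobi : forall s, `[0, L]%classic s ->
  pole_jacobi_field g eps gam s (lam s) (JJ s).

Lemma near_pole s : 0 < s < L -> \forall r \near s,
  [/\ geodesic g (lam r), lam r 0 = gam r
    & eq_tvec (gam r) (velocity A (lam r) 0) (fun i => eps *: velocity A gam r i)].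
Proof.
move=> /andP[s0 sL]; near=> r.
have rL : `[0, L]%classic r.
  rewrite /= in_itv/=; apply/andP; split; apply/ltW; near: r.
    exact: lt_nbhsr.
  exact: lt_nbhsl.
by have [_ _ []] := gam_tractrix rL.
Unshelve. all: by end_near. Qed.

Lemma interior_segment s : 0 < s < L -> `[0, L]%classic s.
Proof. by move=> /andP[s0 sL]; rewrite /= in_itv/= !ltW. Qed.

Lemma pole_derivative s u : 0 < s < L -> 0 <= u ->
  {for s, continuous (lam ^~ u)} /\
  forall i, cdom i (lam s u) -> is_derive s 1 (fun r => coord i (lam r u))
    (eps *: velocity A (lam s) u i + JJ s u i).
Proof.
move=> sL u0; have sI := interior_segment sL.
have [jJ _ J0 dJ0] := JJ_jacobi sI; have [sg _ [gl _ lam0 _] _] := gam_tractrix sI.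
pose i0 := chart_at A (gam s).
have ig : cdom i0 (gam s) := chart_atP A (gam s).
have ig0 : cdom i0 (lam s 0) by rewrite lam0.
apply: (pole_variation eps2 sg (near_pole sL) (i0 := i0)) => //.
- by move=> v; exact: jacobi_regular v jJ.
- by move=> i v; exact: jacobi_linearized gl jJ.
- exact: J0.
- by have := dJ0 i0 ig; rewrite covD_chr (J0 i0 ig) chr0r addr0.
Qed.

Lemma pole_velocity s u : 0 < s < L -> 0 <= u -> forall i, cdom i (lam s u) ->
  velocity A (lam ^~ u) s i = eps *: velocity A (lam s) u i + JJ s u i.
Proof.
by move=> sL u0 i iu; exact: is_derive_derive1 ((pole_derivative sL u0).2 i iu).
Qed.

Lemma pole_velocity_tangent s u : 0 < s < L -> 0 <= u ->
  is_tangent (lam s u) (velocity A (lam ^~ u) s).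
Proof.
move=> sL u0; have sI := interior_segment sL.
have [jJ _ _ _] := JJ_jacobi sI; have [_ _ [gl _ _ _] _] := gam_tractrix sI.
have tv := velocity_tangent (gl u).1.
have tJ := nbhs_singleton (jacobi_regular u jJ).1.
move=> i j iu ju; rewrite !pole_velocity//.
exact: (is_tangent_lin eps tv tJ) i j iu ju.
Qed.

Let W s u := gnorm g (lam s u) (JJ s u).

Lemma pole_ginner s u : 0 < s < L -> 0 <= u ->
  [/\ ginner g (lam s u) (velocity A (lam s) u) (velocity A (lam s) u) = 1,
      ginner g (lam s u) (velocity A (lam ^~ u) s) (velocity A (lam s) u) = eps
    & ginner g (lam s u) (velocity A (lam ^~ u) s) (velocity A (lam ^~ u) s)
        = 1 + W s u ^+ 2].
Proof.
move=> sL u0; have sI := interior_segment sL.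
have [_ Jv _ _] := JJ_jacobi sI; have [_ _ [_ v1 _ _] _] := gam_tractrix sI.
have vv : ginner g (lam s u) (velocity A (lam s) u) (velocity A (lam s) u) = 1.
  by rewrite -gnorm_sqr v1 expr1n.
by have [] := ginner_pythagoras eps2 (pole_velocity sL u0) vv (Jv u).
Qed.

Lemma pole_speed s u : 0 < s < L -> 0 <= u ->
  gnorm g (lam s u) (velocity A (lam ^~ u) s) = Num.sqrt (1 + W s u ^+ 2).
Proof. by move=> sL u0; rewrite /gnorm; have [_ _ ->] := pole_ginner sL u0. Qed.

Lemma pole_area s u : 0 < s < L -> 0 <= u ->
  parallelogram_area g (lam s u) (velocity A (lam ^~ u) s) (velocity A (lam s) u)
    = W s u.
Proof.
move=> sL u0; rewrite /parallelogram_area; have [-> -> ->] := pole_ginner sL u0.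
by rewrite mulr1 [eps ^+ 2]expr2 eps2 addrAC subrr add0r sqrtr_sqr ger0_norm// sqrtr_ge0.
Qed.

(** When kappa = 0 the zero field has the initial data of the Jacobi field, and
    [pole_variation] for both fields computes the same derivative d_s r. *)
Lemma pole_jacobi_curvature s u : 0 < s < L -> 0 <= u ->
  let kappa := geodesic_curvature g gam s in
  kappa * pole_jacobi_norm g (lam s) (JJ s) kappa u = W s u.
Proof.
move=> sL u0 kappa; rewrite /pole_jacobi_norm.
have [k0|k0] := eqVneq kappa 0; last by rewrite mulrCA divff// mulr1.
rewrite k0 mul0r; apply/esym/gnorm_zero.
have sI := interior_segment sL.
have [sg _ [gl _ lam0 _] _] := gam_tractrix sI.
pose i0 := chart_at A (gam s).
have ig : cdom i0 (gam s) := chart_atP A (gam s).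
have cov0 : covD g gam (velocity A gam) s i0 = 0 := gnorm_eq0 k0.
have ip : cdom (chart_at A (lam s u)) (lam s u) := chart_atP A _.
have dJ := (pole_derivative sL u0).2 _ ip.
have [_ /(_ _ ip) d0] : {for s, continuous (lam ^~ u)} /\
    forall i, cdom i (lam s u) -> is_derive s 1 (fun r => coord i (lam r u))
      (eps *: velocity A (lam s) u i + zero_tvec A i).
  apply: (pole_variation eps2 sg (near_pole sL) (K := fun=> zero_tvec A) (i0 := i0)) => //.
  - by move=> v; exact: zero_regular.
  - by move=> i v _; exact: zero_linearized.
  - by rewrite cov0 scaler0; exact: derive1_cst.
exact: (addrI _ (is_derive_unique dJ d0)).
Qed.

Let D : set R := `]0, L[%classic.

Let mD : measurable D. Proof. exact: measurable_itv. Qed.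

(** The speed, and not the Jacobi field, is measurable in s at once: nothing is
    assumed on how JJ s depends on s. *)
Lemma measurable_pole_speed u : 0 <= u ->
  measurable_fun D (fun s => 1 + W s u ^+ 2).
Proof.
move=> u0; apply: (@eq_measurable_fun _ _ _ _ _ (fun s =>
    ginner g (lam s u) (velocity A (lam ^~ u) s) (velocity A (lam ^~ u) s))).
  by move=> s; rewrite inE /D/= in_itv/= => sL; have [_ _ ->] := pole_ginner sL u0.
apply: measurable_ginner_velocity => s sL; split.
- exact: (pole_derivative sL u0).1.
- exact: pole_velocity_tangent.
- by move=> i iu; have [] := (pole_derivative sL u0).2 i iu.
Qed.

Lemma measurable_pole_width u : 0 <= u -> measurable_fun D (W ^~ u).
Proof.
move=> u0; apply: (@eq_measurable_fun _ _ _ _ _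
    (fun s => Num.sqrt (1 + W s u ^+ 2 - 1))).
  by move=> s _; rewrite addrAC subrr add0r sqrtr_sqr ger0_norm// sqrtr_ge0.
apply: measurableT_comp.
  by apply: continuous_measurable_fun; exact: sqrt_continuous.
by apply: measurable_funB => //; exact: measurable_pole_speed.
Qed.

Lemma continuous_pole_width s : 0 < s < L -> continuous (W s).
Proof.
move=> sL u; have sI := interior_segment sL.
have [jJ _ _ _] := JJ_jacobi sI; have [_ _ [gl _ _ _] _] := gam_tractrix sI.
apply: (@continuous_comp _ _ _ (fun u => ginner g (lam s u) (JJ s u) (JJ s u)) Num.sqrt).
  exact: continuous_ginner (gl u).1.1 (jacobi_regular u jJ).
exact: sqrt_continuous.
Qed.

End Poles.

(** The sides of the rectangle do not count, since f is only controlled in the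
    interior, where it is W; what remains is Tonelli's theorem. *)
Lemma integral_iterated_oo (R : realType) (L ell : R) (W f : R -> R -> R) :
  0 <= ell ->
  (forall s u, 0 <= W s u) ->
  (forall u, 0 <= u -> measurable_fun `]0, L[ (W ^~ u)) ->
  (forall s, 0 < s < L -> continuous (W s)) ->
  (forall s u, 0 < s < L -> 0 <= u -> f s u = W s u) ->
  (\int[lebesgue_measure \x lebesgue_measure]_(x in
      (`]0%R, L[ `*` `]0%R, ell[ : set (R * R))) (W x.1 x.2)%:E =
   \int[lebesgue_measure]_(s in `[0%R, L])
      \int[lebesgue_measure]_(u in `[0%R, ell]) (f s u)%:E)%E.
Proof.
move=> ell0 W0 mW cW fW.
pose D : set R := `]0, L[%classic; pose E : set R := `]0, ell[%classic.
have mD : measurable D by exact: measurable_itv.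
have mE : measurable E by exact: measurable_itv.
(* Only the values of W at nonnegative heights are known to be measurable in s;
   composing with the absolute value leaves W unchanged on the rectangle. *)
pose H (s u : R) : R := ((fun s => W s `|u|) \_ D) s.
have mH : measurable_fun setT (fun z : R * R => H z.1 z.2).
  apply: caratheodory_measurable => [u|s].
    by apply/(measurable_restrictT _ mD); exact: mW.
  have [sD|sD] := boolP (s \in D).
    have -> : H s = W s \o (fun u => `|u|).
      by apply/funext => u; rewrite /H patchE sD.
    move=> u; apply: continuous_comp; first exact: norm_continuous.
    by apply: cW; move: sD; rewrite inE /D/= in_itv.
  have -> : H s = cst 0 by apply/funext => u; rewrite /H patchE (negbTE sD).
  exact: cst_continuous.
have H0 z : 0 <= H z.1 z.2 by rewrite /H patchE; case: ifP => _ //; exact: W0.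
pose F : R * R -> \bar R := (fun z => (H z.1 z.2)%:E) \_ (D `*` E).
have mDE : measurable (D `*` E) by exact: measurableX.
have mF : measurable_fun setT F.
  apply/(measurable_restrictT _ mDE)/measurable_funTS.
  exact/measurable_EFinP.
have F0 z : (0 <= F z)%E.
  by rewrite /F patchE; case: ifP => _ //; rewrite lee_fin.
have inner s : D s -> (\int[lebesgue_measure]_(u in `[0%R, ell]) (f s u)%:E =
    \int[lebesgue_measure]_u F (s, u))%E.
  move=> Ds; have sL : 0 < s < L by move: Ds; rewrite /D/= in_itv.
  transitivity (\int[lebesgue_measure]_(u in `[0%R, ell]) (W s u)%:E)%E.
    by apply: eq_integral => u; rewrite inE/= in_itv/= => /andP[u0 _]; rewrite fW.
  rewrite integral_itv_bndoo; last first.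
    apply/measurable_EFinP/measurable_funTS.
    by apply: continuous_measurable_fun; exact: cW.
  rewrite [LHS]integral_mkcond; apply: eq_integral => u _.
  rewrite /F !patchE -/E in_setX /= (mem_set Ds)/=.
  case: ifPn => // uE; rewrite /H patchE (mem_set Ds) ger0_norm//.
  by move: uE; rewrite inE /E/= in_itv/= => /andP[/ltW].
have mFs := measurable_fun_fubini_tonelli_F (m2 := lebesgue_measure) F mF F0.
transitivity (\int[lebesgue_measure \x lebesgue_measure]_z F z)%E.
  rewrite [LHS]integral_mkcond; apply: eq_integral => -[s u] _.
  rewrite /F !patchE -/D -/E; case: ifPn => //; rewrite in_setX/= => /andP[sD uE].
  rewrite /H patchE sD ger0_norm//.
  by move: uE; rewrite inE /E/= in_itv/= => /andP[/ltW].
rewrite fubini_tonelli1// integral_itv_bndoo; last first.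
  apply: (@eq_measurable_fun _ _ _ _ D (fubini_F lebesgue_measure F)).
    by move=> s; rewrite inE => Ds; rewrite /fubini_F inner.
  exact: measurable_funTS.
rewrite [RHS]integral_mkcond; apply: eq_integral => s _.
rewrite patchE -/D /fubini_F; case: ifPn => [|sD].
  by rewrite inE => Ds; rewrite inner.
apply: integral0_eq => u _; rewrite /F patchE in_setX /=.
by rewrite (negbTE sD).
Qed.

Theorem theorem6p1 (R : realType) (n : nat) (M : topologicalType)
    (A : smooth_structure R n M) (g : riemannian_metric A)
    (g_complete : complete_metric g)
    (eps : R) (eps_sign : eps = 1 \/ eps = -1)
    (ell : R) (ell_gt0 : 0 < ell)
    (T : set R) (eta : R -> M) (eta_tractor : tractor_curve A T eta)
    (L : R) (L_ge0 : 0 <= L) (gam : R -> M) (lam : R -> R -> M)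
    (gam_tractrix : tractrix g eps ell T eta L gam lam)
    (JJ : R -> R -> tvec A)
    (JJ_jacobi : forall s, `[0, L]%classic s ->
       pole_jacobi_field g eps gam s (lam s) (JJ s)) :
  let kappa := geodesic_curvature g gam in
  let J := fun s u => pole_jacobi_norm g (lam s) (JJ s) (kappa s) u in
  (curve_length g (fun s => lam s ell) 0 L =
   \int[lebesgue_measure]_(s in `[0%R, L])
      (Num.sqrt (1 + kappa s ^+ 2 * J s ell ^+ 2))%:E)%E /\
  (map_area g lam 0 L 0 ell =
   \int[lebesgue_measure]_(s in `[0%R, L])
      \int[lebesgue_measure]_(u in `[0%R, ell]) (kappa s * J s u)%:E)%E.
Proof.
move=> kappa J.
have eps2 : eps * eps = 1 by case: eps_sign => ->; rewrite ?mulrNN mulr1.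
pose W s u := gnorm g (lam s u) (JJ s u).
have kJ s u : 0 < s < L -> 0 <= u -> kappa s * J s u = W s u.
  exact: pole_jacobi_curvature eps2 gam_tractrix JJ_jacobi s u.
have ell0 := ltW ell_gt0.
split.
- have lenE s : 0 < s < L -> Num.sqrt (1 + kappa s ^+ 2 * J s ell ^+ 2) =
      Num.sqrt (1 + W s ell ^+ 2).
    by move=> sL; rewrite -exprMn kJ.
  rewrite integral_itv_bndoo; last first.
    apply: (@eq_measurable_fun _ _ _ _ _ (fun s => (Num.sqrt (1 + W s ell ^+ 2))%:E)).
      by move=> s; rewrite inE/= in_itv/= => sL; rewrite lenE.
    have msqrt : measurable_fun setT (Num.sqrt : R -> R).
      by apply: continuous_measurable_fun; exact: sqrt_continuous.
    apply/measurable_EFinP; apply: (measurableT_comp msqrt).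
    exact: measurable_pole_speed eps2 gam_tractrix JJ_jacobi ell ell0.
  apply: eq_integral => s; rewrite inE/= in_itv/= => sL.
  by rewrite lenE// (pole_speed eps2 gam_tractrix JJ_jacobi sL ell0).
- have W0 s u : 0 <= W s u by exact: sqrtr_ge0.
  have mW u : 0 <= u -> measurable_fun `]0, L[ (W ^~ u).
    exact: measurable_pole_width eps2 gam_tractrix JJ_jacobi u.
  have cW s : 0 < s < L -> continuous (W s).
    exact: continuous_pole_width gam_tractrix JJ_jacobi s.
  transitivity (\int[lebesgue_measure \x lebesgue_measure]_(x in
      (`]0%R, L[ `*` `]0%R, ell[ : set (R * R))) (W x.1 x.2)%:E)%E.
    apply: eq_integral => -[s u]; rewrite inE/= => -[/=].
    rewrite !in_itv/= => sL /andP[/ltW u0 _].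
    by rewrite (pole_area eps2 gam_tractrix JJ_jacobi sL u0).
  exact: integral_iterated_oo ell0 W0 mW cW kJ.
Qed.
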